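(* Let $d \ge 1$, let $T^* \in [0,+\infty)$, let $H : \mathbb{R}^d \to \mathbb{R}$ be a $\mathcal{C}^2$ strictly convex function and let $f : [0,T^*] \times \mathbb{R}^d \to \mathbb{R}$ be a Lipschitz function. Assume that $u_0 = f(0,\cdot)$ is $\mathcal{C}^{1,1}$, that $f$ satisfies $\partial_t f - H(\nabla_x f) = 0$ almost everywhere, and that there exists a constant $c > 0$ such that for all $t \in [0,T^*]$ the function $x \mapsto c|x|^2 - f(t,x)$ is convex. Then $f$ coincides on $[0,T^*] \times \mathbb{R}^d$ with the unique viscosity solution of $$\begin{cases} \partial_t u - H(\nabla_x u) = 0, \\ u(0,\cdot) = u_0. \end{cases}$$
   Context: $\mathcal{C}^{1,1}$ denotes the space of differentiable functions $\mathbb{R}^d \to \mathbb{R}$ with Lipschitz gradient. $\nabla_x$ is the gradient in the space variable $x$. ''Almost everywhere'' is with respect to Lebesgue measure on $[0,T^*]\times\mathbb{R}^d$; a Lipschitz function is differentiable almost everywhere. Viscosity solutions are understood in the usual sense for $\partial_t u - H(\nabla_x u) = 0$ (for a subsolution: $\partial_t \varphi - H(\nabla_x \varphi) \le 0$ at local maxima of $u - \varphi$, $\varphi$ smooth; for a supersolution: $\ge 0$ at local minima). When $H : \mathbb{R}^d \to \mathbb{R}$ is $\mathcal{C}^2$ and strictly convex and $u_0 : \mathbb{R}^d \to \mathbb{R}$ is Lipschitz and $\mathcal{C}^{1,1}$ (here $u_0 = f(0,\cdot)$ is Lipschitz because $f$ is), it is known that a viscosity solution exists, is unique, and is Lipschitz.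 *)

(* Defs.v *)
From HB Require Import structures.
From mathcomp Require Import all_boot all_order all_algebra.
From mathcomp Require Import all_classical all_reals all_analysis.

Set Implicit Arguments.
Unset Strict Implicit.
Unset Printing Implicit Defensive.

Import Order.TTheory GRing.Theory Num.Theory.
Import numFieldNormedType.Exports.

Local Open Scope classical_set_scope.
Local Open Scope ring_scope.

(* R^d is 'rV[R]_d and [0, T] x R^d is a subset of R * 'rV[R]_d. A function on
   [0, T] x R^d is a total function on R * 'rV[R]_d whose values outside of
   [0, T] x R^d play no role. The library norms on 'rV[R]_d and on products
   are sup norms; they are only used for notions (Lipschitz continuity,
   differentiability, limits) that do not depend on the choice of the norm. *)

Definition sqnorm (R : realType) (d : nat) (x : 'rV[R]_d) : R :=
  \sum_(i < d) x 0 i ^+ 2.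

Definition grad (R : realType) (d : nat) (g : 'rV[R]_d -> R) (x : 'rV[R]_d) :
    'rV[R]_d :=
  \row_(i < d) 'D_(delta_mx 0 i) g x.

Definition partial_t (R : realType) (d : nat) (u : R * 'rV[R]_d -> R)
    (p : R * 'rV[R]_d) : R :=
  derive1 (fun s : R => u (s, p.2)) p.1.

Definition grad_x (R : realType) (d : nat) (u : R * 'rV[R]_d -> R)
    (p : R * 'rV[R]_d) : 'rV[R]_d :=
  grad (fun y => u (p.1, y)) p.2.

(* In finite dimension, g is of class C^(k+1) on the open set U iff it is
   differentiable on U and all its directional derivatives are C^k on U. *)
Fixpoint Ck_on (R : realType) (V : normedModType R) (k : nat) (U : set V)
    (g : V -> R) : Prop :=
  match k with
  | 0 => forall x, U x -> {for x, continuous g}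
  | k'.+1 => (forall x, U x -> differentiable g x) /\
             (forall v : V, Ck_on k' U (fun x => 'D_v g x))
  end.

Definition smooth_on (R : realType) (V : normedModType R) (U : set V)
    (g : V -> R) : Prop :=
  forall k, Ck_on k U g.

Definition C11 (R : realType) (d : nat) (g : 'rV[R]_d -> R) : Prop :=
  (forall x, differentiable g x) /\ lipschitz (grad g).

Definition strictly_convex (R : realType) (d : nat) (g : 'rV[R]_d -> R) :
    Prop :=
  forall (x y : 'rV[R]_d) (s : R), x != y -> 0 < s < 1 ->
    g (s *: x + (1 - s) *: y) < s * g x + (1 - s) * g y.

Definition cylinder (R : realType) (d : nat) (T : R) : set (R * 'rV[R]_d) :=
  [set p | 0 <= p.1 <= T].

Definition open_cylinder (R : realType) (d : nat) (T : R) :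
    set (R * 'rV[R]_d) :=
  [set p | 0 < p.1 < T].

(* Lebesgue measure on R^n, as an iterated product measure on n.-tuples, which
   carry the product sigma-algebra. *)
Fixpoint lebesgue_tuple (R : realType) (n : nat) :
    set (n.-tuple (measurableTypeR R)) -> \bar R :=
  match n with
  | 0 => \d_([tuple])
  | m.+1 => fun A => (@lebesgue_measure R \x @lebesgue_tuple R m)%E
                       [set z : measurableTypeR R * m.-tuple (measurableTypeR R) |
                         A [tuple of z.1 :: z.2]]
  end.

Definition row_of_tuple (R : realType) (d : nat) (s : d.-tuple R) : 'rV[R]_d :=
  \row_(i < d) tnth s i.

(* "The equation holds at p" includes the differentiability of f at p, since
   the derivative operators return a default value where there is no
   derivative. The slices t = 0 and t = T, where differentiability of f depends
   on its values outside of [0, T] x R^d, are negligible. *)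
Definition HJ_ae (R : realType) (d : nat) (H : 'rV[R]_d -> R) (T : R)
    (f : R * 'rV[R]_d -> R) : Prop :=
  \forall z \ae (@lebesgue_measure R \x @lebesgue_tuple R d)%E,
    let p : R * 'rV[R]_d := (z.1, row_of_tuple z.2) in
    cylinder T p -> differentiable f p /\ partial_t f p - H (grad_x f p) = 0.

Definition viscosity_subsolution (R : realType) (d : nat) (H : 'rV[R]_d -> R)
    (T : R) (u : R * 'rV[R]_d -> R) : Prop :=
  forall (phi : R * 'rV[R]_d -> R) (p : R * 'rV[R]_d),
    smooth_on (open_cylinder T) phi -> open_cylinder T p ->
    (\forall q \near p, u q - phi q <= u p - phi p) ->
    partial_t phi p - H (grad_x phi p) <= 0.

Definition viscosity_supersolution (R : realType) (d : nat)
    (H : 'rV[R]_d -> R) (T : R) (u : R * 'rV[R]_d -> R) : Prop :=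
  forall (phi : R * 'rV[R]_d -> R) (p : R * 'rV[R]_d),
    smooth_on (open_cylinder T) phi -> open_cylinder T p ->
    (\forall q \near p, u p - phi p <= u q - phi q) ->
    0 <= partial_t phi p - H (grad_x phi p).

(* Solutions are continuous on [0, T] x R^d; no growth condition is imposed. *)
Definition viscosity_solution (R : realType) (d : nat) (H : 'rV[R]_d -> R)
    (T : R) (u0 : 'rV[R]_d -> R) (u : R * 'rV[R]_d -> R) : Prop :=
  [/\ {within cylinder T, continuous u},
      forall x, u (0, x) = u0 x,
      viscosity_subsolution H T u &
      viscosity_supersolution H T u].

(* Main.v *)
From HB Require Import structures.
Require Import Defs.
From mathcomp Require Import all_boot all_order all_algebra.
From mathcomp Require Import all_classical all_reals all_analysis.
From mathcomp Require Import measurable_realfun.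
From mathcomp Require Import ring lra.
Import Order.TTheory GRing.Theory Num.Theory.
Import numFieldNormedType.Exports.
Local Open Scope classical_set_scope.
Local Open Scope ring_scope.

(** Write [p0 y] for the gradient of [f (0, -)] at [y].  Where the solution is
    smooth, it is affine along the characteristic [t |-> y - t grad H (p0 y)],
    with slope [H p - grad H p . p] at [p = p0 y].  The proof shows that the
    hypotheses force this picture on all of [0, T].

    Convexity of [H] alone gives one inequality.  Since [H] lies above its
    tangent planes, the equation yields, for every [p],
    [f_t - grad H p . grad f >= H p - grad H p . p] almost everywhere.  Almost
    every line of direction [(1, - grad H p)] meets the exceptional set in a
    null set (a shear preserves null sets, then Fubini), so this integrates
    along almost every such line, and along all of them by continuity: this is
    [lower_bound].

    Semiconcavity gives the converse.  Take [p = p0 y], and let [g >= 0] be the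
    excess of [f] over the lower bound along a line close to the
    characteristic.  There [g' = H P - H p - grad H p . (P - p)] with [P] the
    gradient of [f], hence [g' <= C |P - p|^2] because [H] is C^2.  Now the
    lower bound, the C^{1,1} regularity of [f (0, -)] and semiconcavity squeeze
    [f (t, -)] between two paraboloids whose slopes differ by [P - p] and whose
    heights differ by [g]; so [|P - p|^2 <= C g] ([gradient_gap]), up to an
    error that vanishes as the line tends to the characteristic.  Gronwall's
    inequality gives [g = 0] on the characteristic ([characteristic_value]).

    Then [f (t, -)] lies between two paraboloids with the same slope [p0 y] at
    the end of the characteristic of [y].  Such slopes vary in a Lipschitz way
    with a constant independent of [t], which makes the characteristics fill
    space at all times ([char_onto]).  A smooth function touching [f] at a
    point is therefore compelled to have there the jet [(H (p0 y), p0 y)], so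
    [f] is a viscosity solution.

    For uniqueness, let [u] be another solution; nothing is known about its
    growth.  Being a supersolution, [u] satisfies the same lower bound as [f]
    ([supersolution_growth]), so [u >= f].  To bound [u] from above at
    [(t1, x1)] it is compared, on a large ball around [x1], with a smooth
    maximum (log-sum-exp) of [f] and of finitely many affine solutions that
    take at [(t1, x1)] the value of [f].  Jensen's inequality makes it a
    supersolution, and on the lateral boundary the affine solutions dominate
    [u] when the ball is large ([lateral_barrier]): a larger value of [u] would
    travel along a straight line and force a steep increase of [u (t1, -)]
    near [x1].  This replaces any assumption at infinity. *)

Set Implicit Arguments.
Unset Strict Implicit.
Unset Printing Implicit Defensive.

(** * Lebesgue measure on tuples and shears *)

Definition tcons (R : realType) (n : nat)
    (z : (measurableTypeR R * n.-tuple (measurableTypeR R))%type) :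
    n.+1.-tuple (measurableTypeR R) := [tuple of z.1 :: z.2].

Lemma measurable_tcons (R : realType) (n : nat) :
  measurable_fun setT (@tcons R n).
Proof. by apply: measurable_cons. Qed.

(** Products of exhausting sequences for the two factors, read through the
    head and the tail of a tuple, exhaust the space of longer tuples. *)
Lemma sigma_finite_pushforward_tcons (R : realType) (n : nat)
    (mu : {sigma_finite_measure
      set (n.-tuple (measurableTypeR R)) -> \bar R}) :
  sigma_finite setT
    (pushforward (@lebesgue_measure R \x mu)%E (@tcons R n)).
Proof.
have /sigma_finiteP[F [TF ndF Foo]] := sigma_finiteT (@lebesgue_measure R).
have /sigma_finiteP[G [TG ndG Goo]] := sigma_finiteT mu.
pose H k := [set t : n.+1.-tuple (measurableTypeR R) |
  F k (thead t) /\ G k [tuple of behead t]].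
exists H.
  apply/esym; rewrite -subTset => t _.
  have [i _ Fi] : (\bigcup_i F i) (thead t) by rewrite -TF.
  have [j _ Gj] : (\bigcup_i G i) [tuple of behead t] by rewrite -TG.
  exists (maxn i j) => //; split.
    by move: (thead t) Fi; apply/subsetPset/ndF/leq_maxl.
  by move: [tuple of behead t] Gj; apply/subsetPset/ndG/leq_maxr.
move=> k; have [mF Fk] := Foo k; have [mG Gk] := Goo k; split.
  rewrite (_ : H k = (fun t : n.+1.-tuple (measurableTypeR R) => thead t) @^-1`
    F k `&` (fun t : n.+1.-tuple (measurableTypeR R) => [tuple of behead t])
    @^-1` G k) //.
  apply: (measurableI ((fun t : n.+1.-tuple (measurableTypeR R) => thead t)
    @^-1` F k)
    ((fun t : n.+1.-tuple (measurableTypeR R) => [tuple of behead t]) @^-1` G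
      k)).
    by rewrite -[X in measurable X]setTI; exact: measurable_tnth.
  by rewrite -[X in measurable X]setTI; exact: measurable_behead.
rewrite /pushforward (_ : _ @^-1` _ = F k `*` G k).
  by rewrite product_measure1E// lte_mul_pinfty// ge0_fin_numE.
have bK (x : measurableTypeR R) (t : n.-tuple (measurableTypeR R)) :
  [tuple of behead (tcons (x, t))] = t by exact: val_inj.
by apply/seteqP; split => -[x t] /=; rewrite /H /= bK.
Qed.

(** The iterated product is only a set function; Fubini and negligibility need
    it to be a sigma-finite measure, which is proved along its recursion. *)
Lemma lebesgue_tuple_measure (R : realType) (n : nat) :
  exists mu : {sigma_finite_measure
    set (n.-tuple (measurableTypeR R)) -> \bar R},
  @lebesgue_tuple R n = mu.
Proof.
elim: n => [|n [mu IH]] /=.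
  by exists (@dirac _ (0.-tuple (measurableTypeR R)) [tuple] R).
rewrite IH.
unshelve eexists.
  unshelve refine (let P : {measure set _ -> \bar R} :=
    pushforward (@lebesgue_measure R \x mu)%E (@tcons R n) in _).
    exact: measurable_tcons.
  pose mix := Measure_isSigmaFinite.Build _ _ _ P
    (sigma_finite_pushforward_tcons mu).
  exact: (HB.pack (P : set _ -> \bar R) P mix).
by [].
Qed.

(** Translates of half-open intervals keep their length, and this determines
    the measure. *)
Lemma lebesgue_measure_shift (R : realType) (c : R)
  (A : set (measurableTypeR R)) :
  measurable A -> lebesgue_measure
    ((fun x : measurableTypeR R => x + c : measurableTypeR R) @^-1` A) =
    lebesgue_measure A.
Proof.
have mf : measurable_fun setT
  ((fun x : measurableTypeR R => x + c) : measurableTypeR R ->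
  measurableTypeR R).
  exact: measurable_funD.
move=> mA; apply/esym.
apply: (@lebesgue_measure_unique R
  (pushforward lebesgue_measure
  (fun x : measurableTypeR R => x + c : measurableTypeR R))) => //=
  _ [[a b]] _ <-.
rewrite /pushforward /=.
rewrite (_ : (_ @^-1` _) = `](a - c), (b - c)]%classic); last first.
  by apply/seteqP; split => x /=; rewrite !in_itv/= ltrBlDr lerBrDr.
rewrite !lebesgue_measure_itv/= !lte_fin ltrD2r; case: ifP => // _.
by rewrite -!EFinD opprD opprK addrACA addNr addr0.
Qed.

Definition tshift (R : realType) (n : nat) (c : 'I_n -> R)
    (t : n.-tuple (measurableTypeR R)) : n.-tuple (measurableTypeR R) :=
  [tuple tnth t i + c i | i < n].

(** By induction: translate the tails inside the integral over the heads, then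
    change variables in the heads. *)
Lemma lebesgue_tuple_shift (R : realType) (n : nat) (c : 'I_n -> R)
    (A : set (n.-tuple (measurableTypeR R))) :
  measurable A -> lebesgue_tuple (tshift c @^-1` A) = lebesgue_tuple A.
Proof.
elim: n c A => [|n IH] c A mA.
  congr lebesgue_tuple; apply/seteqP; split => t /=;
  by rewrite (tuple0 t) (tuple0 (tshift _ _)).
have [mu muE] := lebesgue_tuple_measure R n.
have mB : measurable (@tcons R n @^-1` A).
  by rewrite -[X in measurable X]setTI; exact: measurable_tcons.
rewrite /= muE /product_measure1.
rewrite -/(@tcons R n @^-1` A).
pose sh (x : measurableTypeR R) : measurableTypeR R := x + c ord0.
pose g x := (mu \o xsection (@tcons R n @^-1` A)) x.
transitivity (\int[@lebesgue_measure R]_(x in setT) (g \o sh) x)%E.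
  apply: eq_integral => x _; rewrite /= /g /= -muE.
  have mx : measurable (xsection (@tcons R n @^-1` A) (sh x)).
    exact: measurable_xsection.
  rewrite -(IH (fun i => c (lift ord0 i)) _ mx).
  congr lebesgue_tuple; apply/seteqP; split => t /=; rewrite /xsection /=
    !inE /= /tcons;
  rewrite (_ : tshift _ _ =
    [tuple of (x + c ord0) :: tshift (fun i => c (lift ord0 i)) t]) //;
  apply: eq_from_tnth => i; rewrite /tshift tnth_mktuple;
  case: (unliftP ord0 i) => [j|] ->; rewrite ?tnthS ?tnth0 // tnth_mktuple //.
transitivity (\int[pushforward (@lebesgue_measure R) sh]_(x in setT) g x)%E.
  rewrite ge0_integral_pushforward ?preimage_setT //.
  - exact: measurable_funD.
  - exact: measurable_fun_xsection.
apply: eq_measure_integral; first exact: measurable_funD.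
by move=> ? B mB' _; exact: (lebesgue_measure_shift (c ord0) mB').
Qed.

(** Positivity on boxes makes conull sets of tuples dense. *)
Lemma lebesgue_tuple_box (R : realType) (n : nat) (c : 'I_n -> R) (e : R) :
  0 < e ->
  let A := [set t : n.-tuple (measurableTypeR R) | forall i, `|tnth t i - c i| <
    e] in
  measurable A /\ (0 < lebesgue_tuple A)%E.
Proof.
move=> e0; elim: n c => [|n IH] c /=.
  rewrite (_ : [set _ | _] = setT); last by apply/seteqP; split => // t _ [].
  by split=> //; rewrite diracT lte_fin.
set A := [set _ | _].
have [mu muE] := lebesgue_tuple_measure R n.
pose B := [set t : n.-tuple (measurableTypeR R) | forall i, `|tnth t i - c
  (lift ord0 i)| < e].
have [mB B0] := IH (fun i => c (lift ord0 i)).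
have mI : measurable (ball (c ord0) e : set (measurableTypeR R))
  by exact: measurable_ball.
split.
  rewrite (_ : A = \bigcap_(i in [set: 'I_n.+1])
    ((tnth (T:=measurableTypeR R))^~ i @^-1` (ball (c i) e))).
    apply: fin_bigcap_measurable => // i _.
    rewrite -[X in measurable X]setTI; apply: measurable_tnth => //.
    exact: measurable_ball.
  apply/seteqP; split => t /= h i; first by move=> _; rewrite /ball/= distrC;
    exact: h.
  by have := h i Logic.I; rewrite /ball/= distrC.
rewrite (_ : [set z | _] = ball (c ord0) e `*` B); last first.
  apply/seteqP; split => -[x t] /=.
    move=> h; split; first by have := h ord0; rewrite tnth0 /ball/= distrC.
    by move=> i; have := h (lift ord0 i); rewrite tnthS.
  move=> [h1 h2] i; case: (unliftP ord0 i) => [j|] ->; rewrite ?tnthS ?tnth0 //.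
  by move: h1; rewrite /ball/= distrC.
rewrite muE.
rewrite [X in (_ < X)%E](_ : _ = lebesgue_measure (ball (c ord0) e) * mu B)%E.
  rewrite -muE mule_gt0 //.
  by rewrite lebesgue_measure_ball ?ltW// lte_fin mulrn_wgt0.
exact: product_measure1E.
Qed.

(** The shear [(s, t) |-> (s, t - s q)] translates every time slice, so it
    preserves null sets. Exchanging the order of integration, almost every
    sheared line meets [N] in a null set of times, and the base points of such
    lines are dense. *)
Lemma null_shear (R : realType) (n : nat) (q c : 'I_n -> R) (e : R)
   (N : set (measurableTypeR R * n.-tuple (measurableTypeR R))%type) :
  0 < e ->
  (@lebesgue_measure R \x @lebesgue_tuple R n)%E.-negligible N ->
  exists t : n.-tuple (measurableTypeR R), (forall i, `|tnth t i - c i| < e) /\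
   (@lebesgue_measure R).-negligible
     [set s | N (s, tshift (fun i => - (s * q i)) t)].
Proof.
move=> e0 [A [mA A0 NA]].
have [mu muE] := lebesgue_tuple_measure R n.
pose S (z : (measurableTypeR R * n.-tuple (measurableTypeR R))%type) :
  (measurableTypeR R * n.-tuple (measurableTypeR R))%type :=
  (z.1, tshift (fun i => - (z.1 * q i)) z.2).
have mS : measurable_fun setT S.
  apply/measurable_fun_pairP; split; first exact: measurable_fst.
  apply/measurable_fun_tnthP => i /=.
  rewrite (_ : _ \o _ = fun z => tnth z.2 i + - (z.1 * q i)); last first.
    by apply/funext => z /=; rewrite /tshift tnth_mktuple.
  apply: measurable_funD.
    apply: (measurableT_comp (f := fun t :
      n.-tuple (measurableTypeR R) => tnth t i)) => //.
    exact: measurable_tnth.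
  by apply: measurable_funN => //; apply: measurable_funM.
have mB : measurable (S @^-1` A).
  by rewrite -[X in measurable X]setTI; exact: mS.
(* Each time slice of the preimage is a translate of that of [A]. *)
have B0 : (lebesgue_measure \x mu)%E (S @^-1` A) = 0%E.
  rewrite -[RHS]A0 muE /product_measure1; apply: eq_integral => s _ /=.
  have mx : measurable (xsection A s) by exact: measurable_xsection.
  rewrite -muE -(lebesgue_tuple_shift (fun i => - (s * q i)) mx).
  by congr lebesgue_tuple; apply/seteqP; split => t /=; rewrite /xsection /=
    !inE.
have B0' : (lebesgue_measure \x^ mu)%E (S @^-1` A) = 0%E.
  rewrite -[RHS]B0; apply/esym.
  apply: (@product_measure_unique _ _ _ _ R (@lebesgue_measure R) mu
    (@lebesgue_measure R \x^ mu)%E) => // X Y mX mY.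
  exact: product_measure2E.
have mfy : measurable_fun setT (lebesgue_measure \o ysection (S @^-1` A)).
  exact: measurable_fun_ysection.
have : ae_eq mu setT (lebesgue_measure \o ysection (S @^-1` A)) (cst 0%E).
  apply/(ae_eq_integral_abs mu measurableT mfy).
  rewrite -[RHS]B0' /product_measure2; apply: eq_integral => t _.
  by rewrite /= gee0_abs.
move=> [Z [mZ Z0 ZP]].
have [mbox box0] := lebesgue_tuple_box c e0.
have [t [bt Zt]] : exists t, (forall i, `|tnth t i - c i| < e) /\ ~ Z t.
  apply: contrapT => h.
  move: box0; rewrite ltNge => /negP; apply; rewrite muE -Z0; apply: le_measure;
    rewrite ?inE //.
  by move=> t /= bt; apply: contrapT => Zt; apply: h; exists t.
exists t; split=> //.
exists (ysection (S @^-1` A) t); split.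
- exact: measurable_ysection.
- by apply: contrapT => h; apply: Zt; apply: ZP => /= h'; apply: h; exact: h'.
- by move=> s /= /NA; rewrite /ysection /= inE.
Qed.

(** * Lipschitz functions with an almost everywhere nonpositive derivative *)

(** Induction on an interval: the supremum of the initial segments on which
    [P] holds cannot lie before [b]. *)
Lemma real_induction (R : realType) (P : R -> Prop) (a b : R) :
  P a ->
  (forall c, a <= c < b -> (forall r, a <= r <= c -> P r) ->
    exists2 e, c < e & forall r, c < r < e -> P r) ->
  (forall c, a < c <= b -> (forall r, a <= r < c -> P r) -> P c) ->
  forall r, a <= r <= b -> P r.
Proof.
move=> Pa Pr Pl r /andP[ar rb].
pose S := [set s | a <= s <= b /\ forall t, a <= t <= s -> P t].
have Sa : S a.
  split; first by rewrite lexx (le_trans ar rb).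
  by move=> t /le_anti <-.
have Sub : ubound S b by move=> s [/andP[]].
have hS : has_sup S by split; [exists a | exists b].
set c := sup S.
have ac : a <= c by exact: (sup_upper_bound hS).
have cb : c <= b by apply: sup_le_ub => //; exists a.
have Pc t : a <= t < c -> P t.
  move=> /andP[at_ tc].
  have d0 : 0 < c - t by rewrite subr_gt0.
  have [s [_ Ss]] := sup_adherent d0 hS.
  by rewrite subKr => ts; apply: Ss; rewrite at_ ltW.
have Pcc : P c.
  move: ac; rewrite le_eqVlt => /orP[/eqP <- //|ac].
  by apply: Pl => //; rewrite ac cb.
have Pc' t : a <= t <= c -> P t.
  move=> /andP[at_]; rewrite le_eqVlt => /orP[/eqP -> //|tc].
  by apply: Pc; rewrite at_ tc.
suff cbE : c = b by apply: Pc'; rewrite ar cbE.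
apply/eqP; rewrite eq_le cb /= leNgt; apply/negP => ltcb.
have [//|e ce Pe] := Pr c _ Pc'; first by rewrite ac ltcb.
pose m := Num.min b ((c + e) / 2).
have cm : c < m by rewrite lt_min ltcb midf_lt.
have me : m < e by rewrite gt_min (@midf_lt _ c e ce).2 orbT.
suff : m <= c by rewrite leNgt cm.
apply: (sup_upper_bound hS); split.
  by rewrite (le_trans ac (ltW cm)) ge_min lexx.
move=> t /andP[at_ tm]; have [tc|ct] := leP t c; first by apply: Pc';
  rewrite at_ tc.
by apply: Pe; rewrite ct (le_lt_trans tm me).
Qed.

(** Cover the exceptional set by an open set [U] of small measure. Outside [U]
    the derivative controls the increments; inside [U] the Lipschitz constant
    does, at a total cost proportional to the measure of [U]. Real induction
    glues the two estimates, without any integration of the derivative. *)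
Lemma lipschitz_ae_nonincreasing (R : realType) (g : R -> R) (a b K : R)
    (N : set (measurableTypeR R)) :
  a <= b -> 
  (forall s t, a <= s <= b -> a <= t <= b -> `|g s - g t| <= K * `|s - t|) ->
  (@lebesgue_measure R).-negligible N ->
  (forall s, a < s < b -> ~ N s -> derivable g s 1 /\ derive1 g s <= 0) ->
  g b <= g a.
Proof.
move=> ab gK [A [mA A0 NA]] gd.
have K0 : 0 <= `|K| by [].
have {}gK s t : a <= s <= b -> a <= t <= b -> `|g s - g t| <= `|K| * `|s - t|.
  move=> hs ht; apply: (le_trans (gK s t hs ht)).
  by rewrite ler_wpM2r// ler_norm.
set K' := `|K| in K0 gK.
apply/ler_addgt0Pr => e0 e0_gt0.
pose e := e0 / (b - a + K' + 1).
have ba : 0 <= b - a by rewrite subr_ge0.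
have den : 0 < b - a + K' + 1 by rewrite ltr_wpDl// addr_ge0.
have e_gt0 : 0 < e by rewrite divr_gt0.
(* Adding the end point [a] lets the covering start the induction, since the
   derivative is only controlled inside the interval. *)
have Aa0 : lebesgue_measure (A `|` [set a]) = 0%E.
  by rewrite measureU0//; exact: lebesgue_measure_set1.
have mAa : measurable (A `|` [set a] : set (measurableTypeR R)).
  exact: measurableU.
have [U [oU AU Ue]] : exists U : set R, [/\ open U, A `|` [set a] `<=` U &
    (lebesgue_measure U < e%:E)%E].
  have Aoo : (lebesgue_measure (A `|` [set a]) < +oo)%E by rewrite Aa0.
  have [U [oU AU Ue]] := lebesgue_regularity_outer mAa Aoo e_gt0.
  exists U; split => //.
  have mU : measurable (U : set (measurableTypeR R)) by exact: open_measurable.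
  have -> : U = (U `\` (A `|` [set a])) `|` (A `|` [set a]).
    by rewrite setUC setDUK.
  by rewrite measureU0//; exact: measurableD.
have mU : measurable (U : set (measurableTypeR R)) by exact: open_measurable.
pose G s := fine (lebesgue_measure (U `&` `[a, s] : set (measurableTypeR R))).
have mUs s : measurable (U `&` `[a, s] : set (measurableTypeR R)).
  exact: measurableI.
have Ufin (B : set (measurableTypeR R)) : measurable B -> B `<=` U ->
    lebesgue_measure B \is a fin_num.
  move=> mB BU; rewrite ge0_fin_numE//;
    apply: le_lt_trans (lt_trans Ue (ltry _)).
  by apply: le_measure; rewrite ?inE.
have GE s : lebesgue_measure (U `&` `[a, s] : set (measurableTypeR R)) =
  (G s)%:E.
  by rewrite fineK// Ufin.
have G0 s : 0 <= G s by rewrite fine_ge0.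
have Ge s : G s <= e.
  rewrite -lee_fin -GE; apply: le_trans (ltW Ue).
  by apply: le_measure; rewrite ?inE.
have Gmono s t : s <= t -> G s <= G t.
  move=> st; rewrite -lee_fin -!GE; apply: le_measure; rewrite ?inE//.
  apply: setIS => x /=; rewrite !in_itv/= => /andP[-> /=] /le_trans; exact.
have Gadd s t : a <= s -> s <= t -> `]s, t]%classic `<=` U -> G s + (t - s) <=
  G t.
  move=> as_ st stU.
  have mst : measurable (`]s, t]%classic : set (measurableTypeR R)) by [].
  have -> : t - s = fine (@lebesgue_measure R `]s, t]%classic).
    rewrite lebesgue_measure_itv/= lte_fin; case: ltP => //= ts.
    by apply/eqP; rewrite subr_eq0 eq_le st ts.
  rewrite -lee_fin EFinD -GE fineK ?Ufin// -measureU//; last first.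
    apply/seteqP; split => x //= -[[_]]; rewrite !in_itv/=
      => /andP[_ xs] /andP[sx _].
    by move: (le_lt_trans xs sx); rewrite ltxx.
  rewrite -GE; apply: le_measure; rewrite ?inE//; first exact: measurableU.
  move=> x [[Ux]|/= xst]; first by rewrite /= !in_itv/= => /andP[-> xs];
    split=> //=; exact: (le_trans xs st).
  split; first exact: stU.
  by move: xst; rewrite /= !in_itv/= => /andP[sx ->];
    rewrite (le_trans as_ (ltW sx)).
pose P s := s <= b -> g s <= g a + e * (s - a) + K' * G s.
suff /(_ (lexx b)) : P b.
  move/le_trans; apply; rewrite -addrA lerD2l.
  have e0E : e * (b - a + K' + 1) = e0 by rewrite /e divfK ?gt_eqF.
  have h1 : K' * G b <= K' * e by rewrite ler_wpM2l.
  rewrite !mulrDr in e0E *; lra.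
apply: (@real_induction R P a b); last by rewrite ab lexx.
- by move=> _; rewrite subrr mulr0 addr0 lerDl mulr_ge0.
- move=> c /andP[ac cb] Pc.
  have gc : g c <= g a + e * (c - a) + K' * G c.
    by apply: Pc (ltW cb); rewrite ac lexx.
  have [Uc|Uc] := pselect (U c).
    have /nbhs_ballP[d /= d0 dU] : nbhs c U by exact: open_nbhs_nbhs.
    exists (c + d); first by rewrite ltrDl.
    move=> r /andP[cr rd] rb.
    have h1 : G c + (r - c) <= G r.
      apply: Gadd => //; first exact: ltW.
      move=> x /=; rewrite in_itv/= => /andP[cx xr]; apply: dU.
      rewrite /ball/= distrC ger0_norm ?subr_ge0 ?ltW//.
      by rewrite ltrBlDl (le_lt_trans xr rd).
    have h2 : g r - g c <= K' * (r - c).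
      have cr0 : 0 <= r - c by rewrite subr_ge0 ltW.
      rewrite -(ger0_norm cr0).
      apply: (le_trans (ler_norm _)).
      by apply: gK; apply/andP; split; lra.
    have h3 : K' * (G c + (r - c)) <= K' * G r by rewrite ler_wpM2l.
    have h4 : e * (c - a) <= e * (r - a) by rewrite ler_wpM2l ?(ltW e_gt0)//;
      lra.
    rewrite mulrDr in h3. lra.
  have ac' : a < c.
    rewrite lt_neqAle ac andbT; apply/eqP => acE; apply: Uc; rewrite -acE.
    by apply: AU; right.
  have Nc : ~ N c by move=> Nc; apply: Uc; apply: AU; left; exact: NA.
  have acb : a < c < b by rewrite ac' cb.
  have [dg dg0] := gd c acb Nc.
  have : \forall h \near 0^', h^-1 * (g (h + c) - g c) < e.
    have cv : h^-1 *: (g (h *: 1 + c) - g c) @[h --> 0^'] --> derive1 g c.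
      by rewrite derive1E; exact: dg.
    apply: filterS (cvgr_lt _ cv _ (le_lt_trans dg0 e_gt0)) => h /=.
    by rewrite [h *: 1]mulr1.
  move=> [d /= d0 dP].
  exists (c + d); first by rewrite ltrDl.
  move=> r /andP[cr rd] rb.
  have rc0 : 0 < r - c by rewrite subr_gt0.
  have := dP (r - c).
  rewrite /ball_/= sub0r normrN gtr0_norm// ltrBlDl => /(_ rd).
  rewrite gt_eqF// subrK => /(_ isT); rewrite mulrC ltr_pdivrMr// => h1.
  have h3 : K' * G c <= K' * G r by rewrite ler_wpM2l// Gmono// ltW.
  have : e * (r - a) = e * (r - c) + e * (c - a) by rewrite -mulrDr;
    congr (_ * _); lra.
  lra.
- move=> c /andP[ac cb] Pc _.
  apply/ler_addgt0Pr => d d0.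
  pose k := d / (K' + 1).
  have K1 : 0 < K' + 1 by rewrite ltr_wpDl.
  have k0 : 0 < k by rewrite divr_gt0.
  pose r := Num.max a (c - k).
  have rc : r < c by rewrite gt_max ac/= gtrBl.
  have ar : a <= r by rewrite le_max lexx.
  have rk : c - k <= r by rewrite le_max lexx orbT.
  have Pr : g r <= g a + e * (r - a) + K' * G r.
    by apply: Pc (ltW (lt_le_trans rc cb)); rewrite ar rc.
  have h1 : g c - g r <= K' * (c - r).
    have cr0 : 0 <= c - r by rewrite subr_ge0 ltW.
    rewrite -(ger0_norm cr0).
    apply: (le_trans (ler_norm _)).
    by apply: gK; apply/andP; split; lra.
  have h2 : K' * (c - r) <= d.
    apply: (@le_trans _ _ (K' * k)); first by rewrite ler_wpM2l//; lra.
    have kE : k * (K' + 1) = d by rewrite /k divfK ?gt_eqF.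
    by rewrite mulrDr in kE; lra.
  have h3 : K' * G r <= K' * G c by rewrite ler_wpM2l// Gmono// ltW.
  have h4 : e * (r - a) <= e * (c - a) by rewrite ler_wpM2l ?(ltW e_gt0)//; lra.
  lra.
Qed.

(** * Scalar product, tangents and compact balls *)

Section dot_product.
Context {R : realType} {d : nat}.
Implicit Types x y z : 'rV[R]_d.

Definition dot x y : R := \sum_(i < d) x 0 i * y 0 i.

Lemma dotC x y : dot x y = dot y x.
Proof. by apply: eq_bigr => i _; rewrite mulrC. Qed.

Lemma dotDr x y z : dot x (y + z) = dot x y + dot x z.
Proof. by rewrite -big_split/=; apply: eq_bigr => i _; rewrite mxE mulrDr. Qed.

Lemma dotDl x y z : dot (y + z) x = dot y x + dot z x.
Proof. by rewrite dotC dotDr !(dotC x). Qed.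

Lemma dotZr a x y : dot x (a *: y) = a * dot x y.
Proof. by rewrite mulr_sumr; apply: eq_bigr => i _; rewrite mxE mulrCA. Qed.

Lemma dotZl a x y : dot (a *: x) y = a * dot x y.
Proof. by rewrite dotC dotZr dotC. Qed.

Lemma dotNr x y : dot x (- y) = - dot x y.
Proof. by rewrite -scaleN1r dotZr mulN1r. Qed.

Lemma dotNl x y : dot (- x) y = - dot x y.
Proof. by rewrite dotC dotNr dotC. Qed.

Lemma dot0r x : dot x 0 = 0.
Proof. by rewrite -[0](scale0r 0) dotZr mul0r. Qed.

Lemma dot0l x : dot 0 x = 0.
Proof. by rewrite dotC dot0r. Qed.

Definition dotE := (dotDl, dotDr, dotNl, dotNr, dotZl, dotZr, dot0l, dot0r).

Lemma dot_suml (I : Type) (r : seq I) (F : I -> 'rV[R]_d) x :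
  dot (\sum_(i <- r) F i) x = \sum_(i <- r) dot (F i) x.
Proof.
by elim/big_rec2: _ => [|i y1 y2 _ <-]; rewrite ?dot0l ?dotDl.
Qed.

Lemma dot_delta x i : dot x (delta_mx 0 i) = x 0 i.
Proof.
rewrite /dot (bigD1 i)//= big1 ?addr0 ?mxE ?eqxx ?mulr1// => j ji.
by rewrite mxE (negbTE ji) andbF mulr0.
Qed.

Lemma sqnormE x : sqnorm x = dot x x.
Proof. by apply: eq_bigr => i _; rewrite expr2. Qed.

Lemma sqnorm_ge0 x : 0 <= sqnorm x.
Proof. by apply: sumr_ge0 => i _; exact: sqr_ge0. Qed.

Lemma sqnorm0 : sqnorm (0 : 'rV[R]_d) = 0.
Proof. by rewrite sqnormE dot0l. Qed.

Lemma sqnormZ a x : sqnorm (a *: x) = a ^+ 2 * sqnorm x.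
Proof. by rewrite !sqnormE !dotE mulrA. Qed.

Lemma sqnormN x : sqnorm (- x) = sqnorm x.
Proof. by rewrite !sqnormE !dotE opprK. Qed.

Lemma sqnormD x y : sqnorm (x + y) = sqnorm x + 2 * dot x y + sqnorm y.
Proof. by rewrite !sqnormE !dotE (dotC y x); lra. Qed.

Lemma sqnormD_le x y : sqnorm (x + y) <= 2 * sqnorm x + 2 * sqnorm y.
Proof.
have := sqnorm_ge0 (x - y); rewrite !sqnormD sqnormN dotNr; lra.
Qed.

Lemma coord_le_norm x i : `|x 0 i| <= `|x|.
Proof.
rewrite [leRHS]/Num.norm /= mx_normrE; apply/bigmax_geP; right => /=.
by exists (0, i).
Qed.

Lemma norm_le_coord x e : 0 <= e -> (forall i, `|x 0 i| <= e) -> `|x| <= e.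
Proof.
move=> e0 h; rewrite [leLHS]/Num.norm /= mx_normrE; apply/bigmax_leP;
  split=> //= -[i j] _ /=.
by rewrite ord1.
Qed.

Lemma sqnorm_le_norm x : sqnorm x <= d%:R * `|x| ^+ 2.
Proof.
apply: (@le_trans _ _ (\sum_(i < d) `|x| ^+ 2)).
  apply: ler_sum => i _; rewrite -real_normK ?num_real//.
  by rewrite lerXn2r ?nnegrE ?coord_le_norm.
by rewrite sumr_const card_ord mulr_natl.
Qed.

(** With [sqnorm_le_norm], compares the Euclidean norm with the sup norm that
    carries the topology. *)
Lemma norm_le_sqnorm x : `|x| ^+ 2 <= sqnorm x.
Proof.
have sq i : `|x 0 i| ^+ 2 <= sqnorm x.
  rewrite real_normK ?num_real// /sqnorm (bigD1 i)//= lerDl.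
  by apply: sumr_ge0 => j _; exact: sqr_ge0.
have : `|x| <= Num.sqrt (sqnorm x).
  apply: norm_le_coord => [|i]; first exact: sqrtr_ge0.
  by rewrite -sqrtr_sqr ler_wsqrtr// -[leLHS]real_normK ?num_real.
move=> h; rewrite -[leRHS]sqr_sqrtr ?sqnorm_ge0//.
by rewrite lerXn2r ?nnegrE ?sqrtr_ge0.
Qed.

Lemma dot_le_norm x y : `|dot x y| <= d%:R * `|x| * `|y|.
Proof.
apply: (le_trans (ler_norm_sum _ _ _)).
apply: (@le_trans _ _ (\sum_(i < d) `|x| * `|y|)).
  by apply: ler_sum => i _; rewrite normrM ler_pM ?coord_le_norm.
by rewrite sumr_const card_ord -mulrA mulr_natl.
Qed.

Lemma linear_dot (L : {linear 'rV[R]_d -> R}) x :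
  L x = dot (\row_i L (delta_mx 0 i)) x.
Proof.
rewrite {1}(row_sum_delta x) linear_sum; apply: eq_bigr => i _.
by rewrite linearZ/= mxE mulrC.
Qed.

End dot_product.

Section gradient.
Context {R : realType} {d : nat}.
Local Notation V := 'rV[R]_d.

Lemma derive_grad (g : V -> R) x v :
  differentiable g x -> 'D_v g x = dot (grad g x) v.
Proof.
move=> dg; rewrite deriveE// linear_dot /grad; congr dot.
by apply/rowP => i; rewrite !mxE deriveE.
Qed.

Lemma derivable_affine (W : normedModType R) (g : W -> R) (x v : W) :
  derivable g x v -> is_derive (0 : R) 1 (fun h : R => g (h *: v + x))
    ('D_v g x).
Proof.
move=> dg; apply: DeriveDef; first exact: (derivable1P g x v).1 dg.
rewrite /derive; set A := (X in lim (X @ _)); set B := (X in _ = lim (X @ _)).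
suff -> : A = B by [].
by apply/funext => h; rewrite /A /B /= addr0 scale0r add0r [h *: 1]mulr1.
Qed.

(** Derivatives at [t] reduce to derivatives at 0, where [derivable_affine]
    computes them along a line. *)
Lemma is_derive_translate (F : R -> R) (t D : R) :
  is_derive (0 : R) 1 (fun h => F (h + t)) D -> is_derive t 1 F D.
Proof.
move=> dF; apply: DeriveDef.
  have := ex_derive (is_derive := dF); rewrite /derivable.
  set A := (X in X @ _); set B := (X in _ -> cvg (X @ _)).
  suff -> : A = B by [].
  by apply/funext => h; rewrite /A /B /= addr0 add0r.
rewrite -(derive_val (is_derive := dF)) /derive.
set A := (X in lim (X @ _)); set B := (X in _ = lim (X @ _)).
suff -> : A = B by [].
by apply/funext => h; rewrite /A /B /= addr0 add0r.
Qed.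

Lemma is_derive_along (W : normedModType R) (g : W -> R) (x v : W) (t : R) :
  derivable g (t *: v + x) v ->
  is_derive t 1 (fun h => g (h *: v + x)) ('D_v g (t *: v + x)).
Proof.
move=> dg; apply: is_derive_translate.
have := derivable_affine dg; congr is_derive.
by apply/funext => h; rewrite scalerDl addrA.
Qed.

Lemma mean_value (W : normedModType R) (g : W -> R) (x v : W) :
  (forall y, derivable g y v) ->
  exists2 t : R, 0 < t < 1 & g (x + v) - g x = 'D_v g (t *: v + x).
Proof.
move=> dg.
have dG (t : R) : is_derive t 1 (fun h => g (h *: v + x)) ('D_v g (t *: v + x)).
  exact: is_derive_along.
have [|t t01] := MVT (@ltr01 R) (fun t _ => dG t).
  apply: continuous_subspaceT => t.
  by apply/differentiable_continuous/derivable1_diffP;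
    exact: (ex_derive (is_derive := dG t)).
rewrite scale1r scale0r add0r subr0 mulr1 (addrC v) => E.
by exists t => //; rewrite in_itv in t01.
Qed.

(** Divide the convexity inequality by [s] and let [s] tend to 0. The error [D
    * s] allows quadratic defects of convexity, as for semiconcave slices. *)
Lemma semiconvex_above_tangent (W : normedModType R) (g : W -> R) (x y : W)
  (D : R) :
  (forall s : R, 0 < s < 1 ->
    g (s *: y + (1 - s) *: x) <= s * g y + (1 - s) * g x + D * s) ->
  derivable g x (y - x) -> g x + 'D_(y - x) g x <= g y + D.
Proof.
move=> gc dg; rewrite -lerBrDl.
have cv : h^-1 *: ((g \o shift x) (h *: (y - x)) - g x) @[h --> 0^'] -->
  'D_(y - x) g x.
  exact: dg.
rewrite leNgt; apply/negP => lt.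
have [e /= e0 eP] := cvgr_gt _ cv _ lt.
pose h := Num.min (e / 2) (1/2).
have h0 : 0 < h by rewrite lt_min; apply/andP; split; lra.
have he : h < e by rewrite gt_min; apply/orP; left; lra.
have h1 : h < 1 by rewrite gt_min; apply/orP; right; lra.
have := eP h; rewrite /ball/= sub0r normrN gtr0_norm// => /(_ he).
rewrite gt_eqF// => /(_ isT); apply/negP; rewrite -leNgt.
have -> : h *: (y - x) + x = h *: y + (1 - h) *: x.
  by rewrite scalerBr scalerBl scale1r addrAC addrA.
rewrite /GRing.scale/= mulrC ler_pdivrMr//.
have := gc h; rewrite h0 h1 => /(_ isT); lra.
Qed.

(** A quadratic term does not affect the derivative: [g - h k + D h^2] has a
    minimum at [h = 0]. The two signs of [h] give the two inequalities. *)
Lemma local_min_derive (W : normedModType R) (g : W -> R) (x v : W) (k : R)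
  (D : R) :
  derivable g x v ->
  (\forall h \near (0 : R), g x + h * k <= g (h *: v + x) + D * h ^+ 2) ->
  'D_v g x = k.
Proof.
move=> dg /nbhs_ballP[e /= e0 eP].
pose G (h : R) := g (h *: v + x) + D * h ^+ 2 - h * k.
have dG : is_derive (0 : R) 1 G ('D_v g x - k).
  have := derivable_affine dg => dg'.
  apply: is_derive_eq.
  by rewrite /GRing.scale /=
    !(mul1r, mulr1, mul0r, mulr0, expr0n, addr0, add0r).
apply/eqP; rewrite -subr_eq0 -(derive_val (is_derive := dG)); apply/eqP.
have cv : h^-1 *: ((G \o shift 0) (h *: 1) - G 0) @[h --> 0^'] --> 'D_1 G 0.
  exact: (ex_derive (is_derive := dG)).
have G0 : G 0 = g x by rewrite /G scale0r add0r expr0n/=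
  mulr0 mul0r addr0 subr0.
have pos h : `|h| < e -> 0 <= G h - G 0.
  move=> he; have := eP h; rewrite /ball/= sub0r normrN G0 /G => /(_ he); lra.
have [lt|lt|//] := ltgtP ('D_1 G 0) 0.
- have [r /= r0 rP] := cvgr_lt _ cv _ lt.
  pose h := Num.min (e / 2) (r / 2).
  have h0 : 0 < h by rewrite lt_min; apply/andP; split; lra.
  have he : h < e by rewrite gt_min; apply/orP; left; lra.
  have hr : h < r by rewrite gt_min; apply/orP; right; lra.
  have := rP h; rewrite /ball/= sub0r normrN gtr0_norm// => /(_ hr).
  rewrite gt_eqF// => /(_ isT); rewrite [h *: 1]mulr1 addr0 /GRing.scale/=.
  rewrite pmulr_rlt0 ?invr_gt0// ltNge pos// gtr0_norm//.
- have [r /= r0 rP] := cvgr_gt _ cv _ lt.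
  pose h := Num.min (e / 2) (r / 2).
  have h0 : 0 < h by rewrite lt_min; apply/andP; split; lra.
  have he : h < e by rewrite gt_min; apply/orP; left; lra.
  have hr : h < r by rewrite gt_min; apply/orP; right; lra.
  have := rP (- h); rewrite /ball/= sub0r opprK gtr0_norm// => /(_ hr).
  rewrite lt_eqF ?oppr_lt0// => /(_ isT);
    rewrite [- h *: 1]mulr1 addr0 /GRing.scale/=.
  rewrite nmulr_rgt0 ?invr_lt0 ?oppr_lt0// ltNge pos// normrN gtr0_norm//.
Qed.

End gradient.

Section compactness.
Context {R : realType}.

Lemma compact_norm_ball (d : nat) (c : 'rV[R]_d) (r : R) :
  compact [set x : 'rV[R]_d | `|x - c| <= r].
Proof.
apply: bounded_closed_compact.
  exists (`|c| + r); split; first exact: num_real.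
  move=> M ltM x /= xr; apply: le_trans (ltW ltM).
  by rewrite -(subrK c x) (le_trans (ler_normD _ _))// addrC lerD2l.
rewrite (_ : [set _ | _] = closed_ball_ Num.norm c r); last first.
  by apply/seteqP; split => x; rewrite /closed_ball_ /= distrC.
exact: closed_closed_ball_.
Qed.

Lemma continuous_bounded_on_compact (T : topologicalType) (g : T -> R)
  (A : set T) :
  compact A -> {within A, continuous g} ->
  exists2 M, 0 <= M & forall x, A x -> `|g x| <= M.
Proof.
move=> cA cg; have [[a Aa]|A0] := pselect (A !=set0); last first.
  by exists 0 => // x Ax; exfalso; apply: A0; exists x.
have [|c cA' cM] := compact_EVT_max (f := fun x => `|g x|) (ex_intro _ a Aa) cA.
  move=> x; apply: continuous_comp; first exact: cg.
  exact: norm_continuous.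
by exists `|g c| => // x Ax; apply: cM; rewrite inE.
Qed.

End compactness.

(** * First-order jets in time and space *)

Section jets.
Context {R : realType} {d : nat}.
Local Notation V := 'rV[R]_d.
Implicit Types (f g : R * V -> R) (p w : R * V) (a b : R) (P Q : V).

Definition has_jet f p a P : Prop :=
  differentiable f p /\ forall w, 'd f p w = w.1 * a + dot P w.2.

Lemma line_pair (h : R) w p : h *: w + p = (h * w.1 + p.1, h *: w.2 + p.2).
Proof. by case: w p => [? ?] [? ?]. Qed.

Lemma derive_line f p w :
  'D_w f p = 'D_1 (fun h : R => f (h * w.1 + p.1, h *: w.2 + p.2)) 0.
Proof.
rewrite /derive; set A := (X in lim (X @ _)); set B := (X in _ = lim (X @ _)).
suff -> : A = B by [].
apply/funext => h; rewrite /A /B /=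
  addr0 [h *: 1]mulr1 mul0r scale0r !add0r -surjective_pairing.
by rewrite line_pair.
Qed.

Lemma partial_t_derive f p : partial_t f p = 'D_((1, 0) : R * V) f p.
Proof.
rewrite derive_line /partial_t derive1E /derive.
set A := (X in lim (X @ _)); set B := (X in _ = lim (X @ _)).
suff -> : A = B by [].
apply/funext => h; rewrite /A /B /=.
by rewrite addr0 [h *: 1]mulr1 mul0r scaler0 !mulr1 scale0r !add0r
  -surjective_pairing.
Qed.

Lemma grad_x_derive f p i : grad_x f p 0 i = 'D_((0, delta_mx 0 i) : R * V) f p.
Proof.
rewrite derive_line /grad_x /grad mxE /derive.
set A := (X in lim (X @ _)); set B := (X in _ = lim (X @ _)).
suff -> : A = B by [].
apply/funext => h; rewrite /A /B /=.
by rewrite addr0 [h *: 1]mulr1 !mulr0 !add0r scale0r add0r -surjective_pairing.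
Qed.

Lemma jet_partial f p a P : has_jet f p a P -> partial_t f p = a /\ grad_x f p =
  P.
Proof.
move=> [df dfE]; split.
  by rewrite partial_t_derive deriveE// dfE/= mul1r dot0r addr0.
by apply/rowP => i; rewrite grad_x_derive deriveE// dfE/= mul0r add0r dot_delta.
Qed.

(** Linearity of the differential splits it between the two variables. *)
Lemma differentiable_jet f p :
  differentiable f p -> has_jet f p (partial_t f p) (grad_x f p).
Proof.
move=> df; split=> // w.
have -> : w = w.1 *: ((1, 0) : R * V) + (0, w.2).
  by case: w => s v; rewrite line_pair /= mulr1 addr0 scaler0 add0r.
rewrite linearD linearZ /= !(mulr1, addr0, scaler0, add0r).
rewrite partial_t_derive deriveE//; congr (_ + _);
  first by rewrite [w.1%:A]mulr1.
pose L : V -> R := fun v => 'd f p (0, v).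
have Llin : linear L.
  move=> k u v; rewrite /L -linearZ/= -linearD; congr ('d f p _).
  by rewrite line_pair /= mulr0 addr0.
pose LM := GRing.isLinear.Build _ _ _ _ L Llin.
pose LL : {linear V -> R} := HB.pack L LM.
rewrite -[LHS]/(LL w.2) linear_dot; congr dot; apply/rowP => i.
by rewrite grad_x_derive mxE deriveE.
Qed.

Lemma jet_derive f p a P w : has_jet f p a P -> 'D_w f p = w.1 * a + dot P w.2.
Proof. by move=> [df dfE]; rewrite deriveE. Qed.

(** Chain rule along the lines [s |-> x - s q], which are the characteristics
    when [q] is the gradient of the Hamiltonian. *)
Lemma jet_is_derive_line f (t : R) (x q : V) a P :
  has_jet f (t, x - t *: q) a P ->
  is_derive t 1 (fun s => f (s, x - s *: q)) (a - dot P q).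
Proof.
move=> jf; have [df _] := jf.
have dl : is_derive (0 : R) 1
    (fun h : R => f (h *: ((1, - q) : R * V) + (t, x - t *: q))) (a - dot P q).
  rewrite (_ : a - dot P q = 'D_((1, - q) : R * V) f (t, x - t *: q)).
    by apply: derivable_affine; exact: diff_derivable.
  by rewrite (jet_derive _ jf)/= mul1r dotNr.
have E : (fun h : R => f (h *: ((1, - q) : R * V) + (t, x - t *: q))) =
  (fun s => f (s, x - s *: q)) \o (fun h => h + t).
  apply/funext => h; rewrite line_pair /= mulr1; congr (f (_, _)).
  by rewrite scalerN addrCA -opprD -scalerDl.
by apply: is_derive_translate; rewrite E in dl.
Qed.

Lemma jet_is_derive_slice f (t : R) x a P v : has_jet f (t, x) a P ->
  is_derive x v (fun y => f (t, y)) (dot P v).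
Proof.
move=> jf; have [df _] := jf.
have E : (fun h : R => h^-1 *:
  (((fun y => f (t, y)) \o shift x) (h *: v) - f (t, x))) =
    (fun h : R => h^-1 *: ((f \o shift (t, x)) (h *: ((0, v) : R * V)) - f
      (t, x))).
  by apply/funext => h; rewrite /= line_pair /= mulr0 add0r.
apply: DeriveDef.
  rewrite /derivable E; exact: (diff_derivable (v := ((0, v) : R * V)) df).
rewrite /derive E; have := jet_derive ((0, v) : R * V) jf.
by rewrite /derive /= mul0r add0r.
Qed.

Lemma coord2_linear a P : linear (fun p : R * V => p.1 * a + dot P p.2).
Proof.
move=> k u v /=; rewrite dotDr dotZr /GRing.scale/=; ring.
Qed.

Lemma affine_continuous a P : continuous (fun p : R * V => p.1 * a + dot P p.2).
Proof.
move=> p; apply: cvgD.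
  by apply: cvgM; [exact: cvg_fst | exact: cvg_cst].
rewrite /dot; apply: cvg_big => [|i _]; first exact: add_continuous.
apply: cvgM; first exact: cvg_cst.
apply: (@continuous_comp _ _ _ snd (fun v : V => v 0 i)); first exact: cvg_snd.
exact: coord_continuous.
Qed.

Lemma jet_cst c p : has_jet (fun _ => c) p 0 0.
Proof.
split; first exact: differentiable_cst.
by move=> w; rewrite diff_cst /= mulr0 dot0l addr0.
Qed.

Lemma jet_linear a P p : has_jet (fun p : R * V => p.1 * a + dot P p.2) p a P.
Proof.
pose LM := GRing.isLinear.Build _ _ _ _ _ (coord2_linear a P).
pose LL : {linear (R * V)%type -> R} :=
  HB.pack (fun p : R * V => p.1 * a + dot P p.2) LM.
have cL : continuous LL by exact: affine_continuous.
split; first by apply: (@linear_differentiable _ _ _ LL p).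
by move=> w; rewrite -[X in 'd X p]/(LL : _ -> _) (diff_lin _ cL).
Qed.

Lemma jetD f g p a b P Q :
  has_jet f p a P -> has_jet g p b Q ->
    has_jet (fun q => f q + g q) p (a + b) (P + Q).
Proof.
move=> [df fE] [dg gE]; split; first exact: differentiableD.
by move=> w; rewrite (diffD df dg) /= fE gE dotDl; ring.
Qed.

Lemma jetM f g p a b P Q :
  has_jet f p a P -> has_jet g p b Q ->
  has_jet (fun q => f q * g q) p (f p * b + g p * a) (f p *: Q + g p *: P).
Proof.
move=> [df fE] [dg gE]; split; first exact: differentiableM.
move=> w; rewrite (diffM df dg) -[LHS]/(f p * 'd g p w + g p * 'd f p w) fE gE
  !dotE /GRing.scale/=; ring.
Qed.

Lemma jetZ k f p a P : has_jet f p a P ->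
  has_jet (fun q => k * f q) p (k * a) (k *: P).
Proof.
move=> jf; have := jetM (jet_cst k p) jf.
by rewrite mulr0 addr0 scaler0 addr0.
Qed.

Lemma jet_sum (I : Type) (r : seq I) (F : I -> R * V -> R) p (a : I -> R)
  (P : I -> V) :
  (forall i, has_jet (F i) p (a i) (P i)) ->
  has_jet (fun q => \sum_(i <- r) F i q) p (\sum_(i <- r) a i)
    (\sum_(i <- r) P i).
Proof.
move=> jF; elim: r => [|i r IH].
  rewrite !big_nil (_ : (fun _ => _) = fun=> 0); first exact: jet_cst.
  by apply/funext => q; rewrite big_nil.
rewrite !big_cons (_ : (fun _ => _) = fun q => F i q + \sum_(j <- r) F j q).
  exact: jetD.
by apply/funext => q; rewrite big_cons.
Qed.

Lemma jet_expR f p a P : has_jet f p a P ->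
  has_jet (fun q => expR (f q)) p (expR (f p) * a) (expR (f p) *: P).
Proof.
move=> [df fE].
have de : differentiable (@expR R) (f p) by apply/derivable1_diffP;
  exact: derivable_expR.
split; first exact: (@differentiable_comp _ _ _ _ f (@expR R)).
move=> w; have E : 'D_1 (@expR R) (f p) =
  expR (f p) by rewrite -[in RHS]derive_expR.
rewrite (@diff_comp _ _ _ _ f (@expR R))//= fE diff1E// derive1E E.
by rewrite dotZl /GRing.scale/=; ring.
Qed.

End jets.

(** * Smooth functions *)

Section smoothness.
Context {R : realType} {W : normedModType R}.
Implicit Types (f g : W -> R) (k : nat).

Lemma Ck_onS k (A B : set W) g : A `<=` B -> Ck_on k B g -> Ck_on k A g.
Proof.
move=> AB; elim: k g => [|k IH] g /=; first by move=> h x /AB; exact: h.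
by move=> [dg Dg]; split=> [x /AB|v]; [exact: dg | exact: IH].
Qed.

Lemma Ck_prev k g : Ck_on k.+1 setT g -> Ck_on k setT g.
Proof.
elim: k g => [|k IH] g /=.
  by move=> [dg _] x _; exact: differentiable_continuous (dg x Logic.I).
by move=> [dg Dg]; split=> // v; exact: IH.
Qed.

Lemma Ck_cst k (c : R) : Ck_on k setT (fun _ : W => c).
Proof.
elim: k c => [|k IH] c /=; first by move=> x _; exact: cvg_cst.
split=> [x _|v]; first exact: differentiable_cst.
rewrite (_ : 'D_v _ = fun=> 0); first exact: IH.
by apply/funext => x; exact: derive_cst.
Qed.

Lemma CkD k f g : Ck_on k setT f -> Ck_on k setT g ->
  Ck_on k setT (fun x => f x + g x).
Proof.
elim: k f g => [|k IH] f g /=.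
  by move=> cf cg x _; apply: cvgD; [exact: cf | exact: cg].
move=> [df Df] [dg Dg]; split=> [x _|v].
  by apply: differentiableD; [exact: df | exact: dg].
rewrite (_ : 'D_v _ = fun x => 'D_v f x + 'D_v g x); first exact: IH.
by apply/funext => x; rewrite -deriveD//; apply: diff_derivable;
  [exact: df|exact: dg].
Qed.

(** The product rule involves the undifferentiated factors, which have enough
    regularity by [Ck_prev]. *)
Lemma CkM k f g : Ck_on k setT f -> Ck_on k setT g ->
  Ck_on k setT (fun x => f x * g x).
Proof.
elim: k f g => [|k IH] f g.
  by move=> cf cg x _; apply: cvgM; [exact: cf | exact: cg].
move=> Cf Cg; have [df Df] := Cf; have [dg Dg] := Cg; split=> [x _|v].
  by apply: differentiableM; [exact: df | exact: dg].
rewrite (_ : 'D_v _ = fun x => f x * 'D_v g x + g x * 'D_v f x).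
  apply: CkD; apply: IH.
  - exact: Ck_prev.
  - exact: Dg.
  - exact: Ck_prev.
  - exact: Df.
by apply/funext => x; rewrite -deriveM//; apply: diff_derivable;
  [exact: df|exact: dg].
Qed.

(** The derivative of [expR \o f] is [expR \o f] times that of [f], so
    regularity propagates by induction on the order. *)
Lemma Ck_expR k f : Ck_on k setT f -> Ck_on k setT (fun x => expR (f x)).
Proof.
elim: k f => [|k IH] f.
  move=> cf x _; apply: (@continuous_comp _ _ _ f (@expR R)); first exact: cf.
  exact: continuous_expR.
move=> Cf; have [df Df] := Cf; split=> [x _|v].
  apply: (@differentiable_comp _ _ _ _ f (@expR R)); first exact: df.
  by apply/derivable1_diffP; exact: derivable_expR.
rewrite (_ : 'D_v _ = fun x => expR (f x) * 'D_v f x).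
  apply: CkM; last exact: Df.
  by apply: IH; exact: Ck_prev.
apply/funext => x.
have dfx := df x Logic.I.
have de : differentiable (@expR R) (f x) by apply/derivable1_diffP;
  exact: derivable_expR.
have E : 'D_1 (@expR R) (f x) = expR (f x) by rewrite -[in RHS]derive_expR.
rewrite !deriveE//; last exact: (@differentiable_comp _ _ _ _ f (@expR R)).
rewrite (@diff_comp _ _ _ _ f (@expR R))//= diff1E// derive1E E.
by rewrite /GRing.scale/= mulrC.
Qed.

Lemma Ck_sum (I : Type) (r : seq I) (F : I -> W -> R) k :
  (forall i, Ck_on k setT (F i)) -> Ck_on k setT (fun x => \sum_(i <- r) F i x).
Proof.
move=> CF; elim: r => [|i r IH].
  rewrite (_ : (fun _ => _) = fun=> 0); first exact: Ck_cst.
  by apply/funext => q; rewrite big_nil.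
rewrite (_ : (fun _ => _) = fun q => F i q + \sum_(j <- r) F j q);
  first exact: CkD.
by apply/funext => q; rewrite big_cons.
Qed.

Lemma CkX k n f : Ck_on k setT f -> Ck_on k setT (fun x => f x ^+ n).
Proof.
move=> Cf; elim: n => [|n IH]; first exact: Ck_cst.
rewrite (_ : (fun x => _) = fun x => f x * f x ^+ n); first exact: CkM.
by apply/funext => x; rewrite exprS.
Qed.

End smoothness.

Lemma Ck_linear (R : realType) (d k : nat) (a : R) (P : 'rV[R]_d) :
  Ck_on k setT (fun p : R * 'rV[R]_d => p.1 * a + dot P p.2).
Proof.
case: k => [|k] /=; first by move=> x _; exact: affine_continuous.
split=> [x _|v]; first by have [] := jet_linear a P x.
rewrite (_ : 'D_v _ = fun=> v.1 * a + dot P v.2); first exact: Ck_cst.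
by apply/funext => x; rewrite (jet_derive _ (jet_linear a P x)).
Qed.

(** * The Hamiltonian and the initial datum *)

Lemma lipschitz_const (R : realType) (V W : normedModType R) (g : V -> W)
  (A : set V) :
  [lipschitz g x | x in A] ->
  exists2 K : R, 0 <= K & forall x y, A x -> A y -> `|g x - g y| <=
    K * `|x - y|.
Proof.
move=> /pinfty_ex_gt0 [K K0 gK]; exists K; first exact: ltW.
by move=> x y Ax Ay; apply: (gK (x, y)); split.
Qed.

Section hamiltonian.
Context {R : realType} {d : nat}.
Local Notation V := 'rV[R]_d.
Variables (H : V -> R).
Hypotheses (HC2 : Ck_on 2 setT H) (Hconv : strictly_convex H).

Lemma C2_differentiable x : differentiable H x.
Proof. by have [dH _] := HC2; exact: dH. Qed.

Lemma gradient_inequality p p' : H p + dot (grad H p) (p' - p) <= H p'.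
Proof.
rewrite -derive_grad; last exact: C2_differentiable.
rewrite -[leRHS]addr0.
apply: semiconvex_above_tangent; last exact/diff_derivable/C2_differentiable.
move=> s /andP[s0 s1]; rewrite mul0r addr0.
have [->|pp] := eqVneq p' p.
  by rewrite -scalerDl -mulrDl addrC subrK scale1r mul1r.
by apply/ltW/Hconv; rewrite ?s0.
Qed.

(** The second derivatives are bounded on the ball by compactness; apply the
    mean value theorem to each first derivative. *)
Lemma grad_locally_lipschitz (M : R) : exists2 C, 0 <= C &
  forall p p' : V, `|p| <= M -> `|p'| <= M ->
    `|grad H p' - grad H p| <= C * `|p' - p|.
Proof.
have [dH DH] := HC2.
pose h i : V -> R := 'D_(delta_mx 0 i) H.
have dh i x : differentiable (h i) x by have [+ _] := DH (delta_mx 0 i); apply.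
have bnd i j : exists2 c, 0 <= c &
    forall x : V, `|x| <= M -> `|'D_(delta_mx 0 j) (h i) x| <= c.
  have [|c c0 cP] := @continuous_bounded_on_compact R _
    ('D_(delta_mx 0 j) (h i)) _ (@compact_norm_ball R d 0 M).
    apply: continuous_subspaceT => x.
    by have [_ /(_ (delta_mx 0 j))] := DH (delta_mx 0 i); apply.
  by exists c => // x xM; apply: cP; rewrite /= subr0.
have [c cP] : exists c : 'I_d -> 'I_d -> R, forall i j, 0 <= c i j /\
    forall x : V, `|x| <= M -> `|'D_(delta_mx 0 j) (h i) x| <= c i j.
  have /choice[c cP] : forall ij : 'I_d * 'I_d, exists c : R, 0 <= c /\
      forall x : V, `|x| <= M -> `|'D_(delta_mx 0 ij.2) (h ij.1) x| <= c.
    by move=> [i j]; have [c c0 cP] := bnd i j; exists c.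
  by exists (fun i j => c (i, j)) => i j; exact: (cP (i, j)).
pose C := \sum_i \sum_j c i j.
have cC i : \sum_j c i j <= C.
  rewrite /C [leRHS](bigD1 i)//= lerDl; apply: sumr_ge0 => k _.
  by apply: sumr_ge0 => j _; have [] := cP k j.
have C0 : 0 <= C by apply: sumr_ge0 => i _; apply: sumr_ge0 => j _; have [] :=
  cP i j.
exists C => // p p' pM p'M; apply: norm_le_coord => [|i]; first exact: mulr_ge0.
rewrite !mxE -/(h i).
have [t t01] : exists2 t : R, 0 < t < 1 &
    h i (p + (p' - p)) - h i p = 'D_(p' - p) (h i) (t *: (p' - p) + p).
  by apply: mean_value => y; exact: diff_derivable.
rewrite (addrC p) subrK => ->.
rewrite derive_grad//; set y := _ + p.
have yM : `|y| <= M.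
  rewrite /y scalerBr addrAC -addrA addrC.
  rewrite (_ : p - _ = (1 - t) *: p); last by rewrite scalerBl scale1r.
  move: t01 => /andP[t0 t1].
  rewrite (le_trans (ler_normD _ _))// !normrZ !gtr0_norm ?subr_gt0//.
  have := ler_wpM2l (ltW t0) p'M.
  have t1' : 0 <= 1 - t by lra.
  have := ler_wpM2l t1' pM; lra.
apply: (le_trans (ler_norm_sum _ _ _)).
apply: (@le_trans _ _ (\sum_j c i j * `|p' - p|)).
  apply: ler_sum => j _; rewrite normrM ler_pM ?coord_le_norm// mxE.
  by have [_] := cP i j; apply.
by rewrite -mulr_suml ler_wpM2r.
Qed.

(** By convexity, [H p' - H p] is at most [dot (grad H p') (p' - p)], so a
    Lipschitz bound on the gradient suffices. *)
Lemma quadratic_upper_bound (M : R) : exists2 C, 0 <= C &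
  forall p p' : V, `|p| <= M -> `|p'| <= M ->
    H p' - H p - dot (grad H p) (p' - p) <= C * sqnorm (p' - p).
Proof.
have [C C0 CP] := grad_locally_lipschitz M.
exists (d%:R * C); first exact: mulr_ge0.
move=> p p' pM p'M.
have h1 := gradient_inequality p' p.
have h2 : dot (grad H p' - grad H p) (p' - p) <= d%:R * C * sqnorm (p' - p).
  apply: (le_trans (ler_norm _)); apply: (le_trans (dot_le_norm _ _)).
  rewrite -!mulrA ler_wpM2l//.
  apply: (@le_trans _ _ ((C * `|p' - p|) * `|p' - p|));
    first by rewrite ler_wpM2r// CP.
  by rewrite -mulrA ler_wpM2l// -expr2 norm_le_sqnorm.
have h3 : dot (grad H p') (p - p') =
  - dot (grad H p') (p' - p) by rewrite -dotNr opprB.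
rewrite dotDl dotNl in h2; lra.
Qed.

End hamiltonian.

Lemma C11_lower_bound (R : realType) (d : nat) (g : 'rV[R]_d -> R) :
  C11 g -> exists2 C, 0 < C & forall y z,
    g y + dot (grad g y) z - C * sqnorm z <= g (y + z).
Proof.
move=> [dg /lipschitz_const[L L0 LP]].
exists (d%:R * L + 1); first by rewrite ltr_wpDl// mulr_ge0.
move=> y z.
have [t /andP[t0 t1]] : exists2 t : R, 0 < t < 1 & g (y + z) - g y =
  'D_z g (t *: z + y).
  by apply: mean_value => x; exact: diff_derivable.
rewrite derive_grad//; set w := _ + y => E.
have h : - (d%:R * L * sqnorm z) <= dot (grad g w - grad g y) z.
  rewrite lerNl; apply: (@le_trans _ _ `|dot (grad g w - grad g y) z|).
    by rewrite -normrN ler_norm.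
  apply: (le_trans (dot_le_norm _ _)).
  rewrite -!mulrA ler_wpM2l//.
  apply: (@le_trans _ _ ((L * `|z|) * `|z|)); last first.
    by rewrite -mulrA ler_wpM2l// -expr2 norm_le_sqnorm.
  rewrite ler_wpM2r//; apply: (le_trans (LP w y _ _)) => //.
  rewrite ler_wpM2l// /w addrK normrZ gtr0_norm//.
  by rewrite ler_piMl// ltW.
rewrite dotDl dotNl in h; have := sqnorm_ge0 z; lra.
Qed.

Lemma lipschitz_grad_bound (R : realType) (d : nat) (g : 'rV[R]_d -> R) (K : R)
  (x : 'rV[R]_d) :
  0 <= K -> (forall v, derivable g x v) ->
  (forall y, `|g y - g x| <= K * `|y - x|) -> `|grad g x| <= K.
Proof.
move=> K0 dg gK; apply: norm_le_coord => // i; rewrite mxE.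
have cv : h^-1 *: ((g \o shift x) (h *: delta_mx 0 i) - g x) @[h --> 0^'] -->
    'D_(delta_mx 0 i) g x by exact: dg.
have cvn : `|h^-1 *: ((g \o shift x) (h *: delta_mx 0 i) - g x)| @[h --> 0^']
  -->
    `|'D_(delta_mx 0 i) g x| by exact: cvg_norm.
rewrite -(cvg_lim _ cvn)//; apply: limr_le; first by apply/cvg_ex; eexists;
  exact: cvn.
have nd : `|delta_mx 0 i : 'rV[R]_d| <= 1.
  apply: norm_le_coord => // j; rewrite mxE eqxx /=.
  by case: (j == i); rewrite ?normr1 ?normr0.
exists 1 => //= h _ h0.
rewrite normrZ normfV mulrC ler_pdivrMr ?normr_gt0//.
have := gK (h *: delta_mx 0 i + x).
have hn : `|h| * `|delta_mx 0 i : 'rV[R]_d| <= `|h| by rewrite ler_piMr.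
by move=> /le_trans; apply; rewrite ler_wpM2l// addrK normrZ.
Qed.

(** * Gronwall's inequality for Lipschitz functions *)

Lemma expRN_lipschitz (R : realType) (A s t : R) : 0 < A -> 0 <= s -> 0 <= t ->
  `|expR (- (A * s)) - expR (- (A * t))| <= A * `|s - t|.
Proof.
move=> A0; wlog st : s t / s <= t.
  move=> W s0 t0; have [/W|/ltW/W] := leP s t; first exact.
  by rewrite distrC (distrC s); exact.
move=> s0 t0.
rewrite (distrC s) (ger0_norm (_ : 0 <= t - s)) ?subr_ge0// ger0_norm;
  last first.
  by rewrite subr_ge0 ler_expR lerN2 ler_pM2l.
have -> : expR (- (A * t)) = expR (- (A * s)) * expR (- (A * (t - s))).
  by rewrite -expRD; congr expR; ring.
have e1 : expR (- (A * s)) <= 1 by rewrite expR_le1 oppr_le0 mulr_ge0// ltW.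
have e0 := expR_ge0 (- (A * s)).
have h := expR_ge1Dx (- (A * (t - s))).
have h' : 0 <= A * (t - s) by rewrite mulr_ge0 ?subr_ge0// ltW.
have := ler_wpM2l e0 h; nra.
Qed.

(** The function [(g + B) expR (- A s)] is Lipschitz, with a nonpositive
    derivative almost everywhere. *)
Lemma gronwall_ae (R : realType) (g : R -> R) (b K A B : R)
    (N : set (measurableTypeR R)) :
  0 <= b -> 0 < A -> 0 <= B ->
  (forall s t, 0 <= s <= b -> 0 <= t <= b -> `|g s - g t| <= K * `|s - t|) ->
  (@lebesgue_measure R).-negligible N ->
  (forall s, 0 < s < b -> ~ N s -> derivable g s 1 /\ derive1 g s <=
    A * (g s + B)) ->
  g 0 = 0 -> g b <= B * expR (A * b).
Proof.
move=> b0 A0 B0 gK N0 gd g0.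
pose e s := expR (- (A * s)).
pose G s := (g s + B) * e s.
have e0 s : 0 < e s by exact: expR_gt0.
have e1 s : 0 <= s -> e s <= 1 by move=> s0;
  rewrite expR_le1 oppr_le0 mulr_ge0// ltW.
have gb s : 0 <= s <= b -> `|g s + B| <= `|K| * b + B.
  move=> sb; rewrite (le_trans (ler_normD _ _))// (ger0_norm B0) lerD2r.
  have := gK s 0 sb; rewrite lexx b0 g0 !subr0 => /(_ isT).
  move: sb => /andP[s0 sb]; rewrite (ger0_norm s0) => /le_trans; apply.
  by rewrite (le_trans (ler_wpM2r s0 (ler_norm K)))// ler_wpM2l.
have GK s t : 0 <= s <= b -> 0 <= t <= b ->
    `|G s - G t| <= (`|K| + (`|K| * b + B) * A) * `|s - t|.
  move=> sb tb; have /andP[s0 _] := sb; have /andP[t0 _] := tb.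
  have -> : G s - G t = (g s - g t) * e s + (g t + B) * (e s - e t).
    by rewrite /G; ring.
  rewrite (le_trans (ler_normD _ _))// [leRHS]mulrDl lerD// normrM.
    rewrite (gtr0_norm (e0 s)) -[leRHS]mulr1 ler_pM ?(ltW (e0 s)) ?e1//.
    by rewrite (le_trans (gK s t sb tb))// ler_wpM2r// ler_norm.
  by rewrite -mulrA ler_pM ?gb// expRN_lipschitz.
have : G b <= G 0.
  apply: (@lipschitz_ae_nonincreasing R G 0 b _ N b0 GK N0) => s sb Ns.
  have [dg dg0] := gd s sb Ns.
  have ig : is_derive s 1 g (derive1 g s) by rewrite derive1E;
    exact: derivableP.
  have ie : is_derive s 1 e (- A * e s).
    rewrite /e; apply: is_derive_eq.
    by rewrite /GRing.scale/= mulr1 mulrC.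
  have iG : is_derive s 1 G (derive1 g s * e s + (g s + B) * (- A * e s)).
    rewrite /G; apply: is_derive_eq.
    rewrite /GRing.scale/=; ring.
  split; first exact: (ex_derive (is_derive := iG)).
  rewrite derive1E (derive_val (is_derive := iG)).
  have -> : derive1 g s * e s + (g s + B) * (- A * e s) =
    (derive1 g s - A * (g s + B)) * e s by ring.
  by rewrite mulr_le0_ge0 ?subr_le0// ltW.
rewrite /G g0 add0r /e mulr0 oppr0 expR0 mulr1 expRN.
rewrite ler_pdivrMr ?expR_gt0// => h.
by apply: le_trans h; rewrite lerDl.
Qed.

(** * The solution along characteristics *)

Lemma row_of_tuple_tshift (R : realType) (d : nat) (q : 'rV[R]_d) (s : R)
    (t : d.-tuple (measurableTypeR R)) :
  row_of_tuple (tshift (fun i => - (s * q 0 i)) t) = row_of_tuple t - s *: q.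
Proof. by apply/rowP => i; rewrite !mxE /tshift tnth_mktuple. Qed.

(** Convexity of [c |x|^2 - f (t, x)] in a form that is invariant under
    translations of [x]. *)
Definition semiconcave_slices (R : realType) (d : nat) (T c : R)
    (f : R * 'rV[R]_d -> R) : Prop :=
  forall t x h s, 0 <= t <= T -> 0 <= s <= 1 ->
    s * f (t, x + h) + (1 - s) * f (t, x) - c * (s * (1 - s)) * sqnorm h <=
    f (t, x + s *: h).

Lemma semiconcave_of_convex (R : realType) (d : nat) (T c : R)
    (f : R * 'rV[R]_d -> R) :
  (forall t : R, 0 <= t <= T ->
     convex_function setT (fun x : 'rV[R]_d => c * sqnorm x - f (t, x))) ->
  semiconcave_slices T c f.
Proof.
move=> fc t x h s tT /andP[s0 s1].
have : c * sqnorm (s *: (x + h) + (1 - s) *: x) - f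
  (t, s *: (x + h) + (1 - s) *: x)
    <= s * (c * sqnorm (x + h) - f (t, x + h)) + (1 - s) *
      (c * sqnorm x - f (t, x)).
  exact: (fc t tT (Itv01 s0 s1) (x + h) x (mem_setT _) (mem_setT _)).
have -> : s *: (x + h) + (1 - s) *: x = x + s *: h.
  by rewrite scalerDr scalerBl scale1r addrC addrA subrK.
rewrite !sqnormD !sqnormZ dotZr; nra.
Qed.

(** Characteristics of gradient [p] move with velocity [- char_speed H p]. *)
Definition char_speed (R : realType) (d : nat) (H : 'rV[R]_d -> R)
  (p : 'rV[R]_d) :
  'rV[R]_d := grad H p.

(** The slope of the solution along a characteristic of gradient [p]; it is
    minus the Legendre transform of [H] at [grad H p]. *)
Definition char_rate (R : realType) (d : nat) (H : 'rV[R]_d -> R) (p : 'rV[R]_d)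
  : R :=
  H p - dot (grad H p) p.

Definition init_grad (R : realType) (d : nat) (f : R * 'rV[R]_d -> R)
  (y : 'rV[R]_d) :
  'rV[R]_d := grad (fun x => f (0, x)) y.

(** The point reached at time [t] by the characteristic issued from [y]. *)
Definition char_map (R : realType) (d : nat) (H : 'rV[R]_d -> R)
    (f : R * 'rV[R]_d -> R) (t : R) (y : 'rV[R]_d) : 'rV[R]_d :=
  y - t *: char_speed H (init_grad f y).

Section ae_solution.
Context {R : realType} {d : nat}.
Local Notation V := 'rV[R]_d.
Variables (T : R) (T0 : 0 <= T) (H : V -> R) (f : R * V -> R) (c K : R).
Hypotheses (HC2 : Ck_on 2 setT H) (Hconv : strictly_convex H).
Hypotheses (K0 : 0 <= K)
  (fK : forall p q, cylinder T p -> cylinder T q -> `|f p - f q| <=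
    K * `|p - q|).
Hypothesis f0C11 : C11 (fun x => f (0, x)).
Hypothesis fae : HJ_ae H T f.
Hypotheses (c0 : 0 < c) (fsc : semiconcave_slices T c f).

Lemma lipschitz_x t x y : 0 <= t <= T -> `|f (t, x) - f (t, y)| <= K * `|x - y|.
Proof.
move=> tT; apply: (le_trans (fK _ _)) => //.
rewrite ler_wpM2l// prod_normE /= subrr normr0 ge_max lexx andbT.
exact: normr_ge0.
Qed.

Local Notation char_speed := (@char_speed R d H).
Local Notation char_rate := (@char_rate R d H).
Local Notation g0 := (@init_grad R d f).
Local Notation char := (@char_map R d H f).

Lemma lipschitz_line (q z : V) s t : 0 <= s <= T -> 0 <= t <= T ->
  `|f (s, z - s *: q) - f (t, z - t *: q)| <= K * (1 + `|q|) * `|s - t|.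
Proof.
move=> sT tT; have := @fK (s, z - s *: q) (t, z - t *: q) sT tT;
  move=> /le_trans; apply.
rewrite -mulrA ler_wpM2l// prod_normE /= ge_max.
have -> : z - s *: q - (z - t *: q) = (t - s) *: q.
  by rewrite scalerBl opprB [LHS]addrC addrA subrK.
rewrite normrZ (distrC t) mulrDl mul1r (mulrC `|q|).
have h1 := normr_ge0 (s - t); have h2 := mulr_ge0 h1 (normr_ge0 q).
by apply/andP; split; lra.
Qed.

(** This is [null_shear] for the exceptional set of the equation. *)
Lemma good_line (q z0 : V) e : 0 < e -> exists2 z, `|z - z0| < e &
  exists2 N : set (measurableTypeR R), (@lebesgue_measure R).-negligible N &
    forall s, 0 <= s <= T -> ~ N s ->
      exists P, has_jet f (s, z - s *: q) (H P) P.
Proof.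
move=> e0.
have e2 : 0 < e / 2 by lra.
have [t [tz N0]] := null_shear (fun i => q 0 i) (fun i => z0 0 i) e2 fae.
exists (row_of_tuple t).
  apply: (@le_lt_trans _ _ (e / 2)); last lra.
  by apply: norm_le_coord => [|i]; [exact: ltW | rewrite !mxE ltW].
exists [set s | ~ (cylinder T (s, row_of_tuple t - s *: q) ->
  differentiable f (s, row_of_tuple t - s *: q) /\
  partial_t f (s, row_of_tuple t - s *: q) - H
    (grad_x f (s, row_of_tuple t - s *: q)) = 0)].
  apply: negligibleS N0 => s /= h.
  by rewrite row_of_tuple_tshift.
move=> s sT /contrapT /(_ sT) [df eq0].
exists (grad_x f (s, row_of_tuple t - s *: q)).
have := differentiable_jet df; congr has_jet.
by apply/eqP; rewrite -subr_eq0 eq0.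
Qed.

Lemma f0_grad_bound y : `|g0 y| <= K.
Proof.
have [df0 _] := f0C11.
apply: lipschitz_grad_bound => //; first by move=> v; exact: diff_derivable.
by move=> x; apply: lipschitz_x; rewrite lexx T0.
Qed.

Lemma jet_grad_bound t x a P : 0 <= t <= T -> has_jet f (t, x) a P -> `|P| <= K.
Proof.
move=> tT jf; have [_ <-] := jet_partial jf.
apply: lipschitz_grad_bound => //.
  by move=> v; exact: (ex_derive (is_derive := jet_is_derive_slice v jf)).
by move=> y; exact: lipschitz_x.
Qed.

(** On a good line, with [P] the gradient of [f], the slope of [f] is [H P -
    dot (grad H p) P], which is at least [char_rate p] by convexity of [H]. Good
    lines are dense and [f] is continuous. *)
Lemma lower_bound p t z : 0 <= t <= T ->
  f (0, z) + t * char_rate p <= f (t, z - t *: char_speed p).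
Proof.
move=> tT; set q := char_speed p.
apply/ler_addgt0Pr => e e0.
pose e' := e / (2 * K + 1).
have e'0 : 0 < e' by rewrite divr_gt0// ltr_wpDl// mulr_ge0.
have [z' zz' [N N0 NP]] := good_line q z e'0.
have /andP[t0 tT'] := tT.
have sub s : 0 <= s <= t -> 0 <= s <= T by lra.
pose g s := - f (s, z' - s *: q) + s * char_rate p.
have : g t <= g 0.
  apply: (@lipschitz_ae_nonincreasing R g 0 t (K * (1 + `|q|) + `|char_rate p|)
    N t0) => //.
    move=> s r /sub sT /sub rT.
    have -> : g s - g r = (f (r, z' - r *: q) - f (s, z' - s *: q)) + (s - r) *
      char_rate p.
      by rewrite /g; ring.
    rewrite (le_trans (ler_normD _ _))// [leRHS]mulrDl lerD//;
      last by rewrite normrM mulrC.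
    by rewrite distrC lipschitz_line.
  move=> s /andP[s0 st] Ns.
  have [|P jP] := NP s _ Ns; first by apply: sub; rewrite !ltW.
  have ig : is_derive s 1 g (- (H P - dot P q) + char_rate p).
    have id := jet_is_derive_line jP.
    rewrite /g; apply: is_derive_eq.
    by rewrite /GRing.scale/=; ring.
  split; first exact: (ex_derive (is_derive := ig)).
  rewrite derive1E (derive_val (is_derive := ig)).
  have := gradient_inequality HC2 Hconv p P.
  rewrite dotDr dotNr /char_rate -/(char_speed p) -/q (dotC q P); lra.
rewrite /g !scale0r !subr0 mul0r addr0 => h1.
have zT : 0 <= (0 : R) <= T by rewrite lexx T0.
have h2 : `|f (0, z) - f (0, z')| <= K * e'.
  by rewrite (le_trans (lipschitz_x _ _ zT))// ler_wpM2l// distrC ltW.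
have h3 : `|f (t, z' - t *: q) - f (t, z - t *: q)| <= K * e'.
  rewrite (le_trans (lipschitz_x _ _ tT))// ler_wpM2l// ltW//.
  by rewrite opprB addrA subrK.
have h4 : (2 * K + 1) * e' =
  e by rewrite mulrC divfK// gt_eqF// ltr_wpDl// mulr_ge0.
move: h2 h3; rewrite !ler_norml => /andP[h2 h2'] /andP[h3 h3'].
lra.
Qed.

(** Up to the defect [c * sqnorm h] absorbed by [semiconvex_above_tangent],
    the opposite of a slice of [f] is convex. *)
Lemma tangent_upper_bound t x a P h : 0 <= t <= T -> has_jet f (t, x) a P ->
  f (t, x + h) <= f (t, x) + dot P h + c * sqnorm h.
Proof.
move=> tT jf.
have id : is_derive x (x + h - x) (fun y => - f (t, y)) (- dot P h).
  rewrite (addrC x) addrK; have id := jet_is_derive_slice h jf.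
  exact: is_deriveN.
have := @semiconvex_above_tangent _ _ (fun y => - f (t, y)) x (x + h)
  (c * sqnorm h).
rewrite (derive_val (is_derive := id)).
suff semi : forall s, 0 < s < 1 ->
    - f (t, s *: (x + h) + (1 - s) *: x) <=
    s * - f (t, x + h) + (1 - s) * - f (t, x) + c * sqnorm h * s.
  move=> /(_ semi (ex_derive (is_derive := id))); lra.
move=> s /andP[s0 s1].
have -> : s *: (x + h) + (1 - s) *: x = x + s *: h.
  by rewrite scalerDr scalerBl scale1r addrC addrA subrK.
have s01 : 0 <= s <= 1 by rewrite !ltW.
have := fsc x h tT s01; have := sqnorm_ge0 h => h0 h1.
have : 0 <= c * sqnorm h * s ^+ 2 by rewrite !mulr_ge0 ?sqr_ge0// ltW.
have -> : c * sqnorm h * s ^+ 2 =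
  c * sqnorm h * s - c * (s * (1 - s)) * sqnorm h by ring.
lra.
Qed.

(** Below [f (s, -)] there is the paraboloid transported by [lower_bound] from
    time 0, above it the one of [tangent_upper_bound]. Compare them at the
    displacement proportional to the difference of their slopes that optimises
    the resulting inequality. *)
Lemma gradient_gap (C0 : R) y z s a P (h0 : 0 < C0) :
  (forall y z, f (0, y) + dot (g0 y) z - C0 * sqnorm z <= f (0, y + z)) ->
  0 <= s <= T ->
  let q := char_speed y in
  has_jet f (s, z - s *: q) a P ->
  sqnorm (g0 z - P) <=
    4 * (C0 + c) * (f (s, z - s *: q) - f (0, z) - s * char_rate y).
Proof.
move=> f0lb sT q jf; set p' := g0 z.
have key h : dot (p' - P) h <=
    (f (s, z - s *: q) - f (0, z) - s * char_rate y) + (C0 + c) * sqnorm h.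
  have h1 := lower_bound y (z + h) sT.
  have h2 := tangent_upper_bound h sT jf.
  have h3 := f0lb z h.
  rewrite -/q -/p' in h1 h3.
  have E : z + h - s *: q = z - s *: q + h by rewrite addrAC.
  rewrite E in h1; rewrite dotDl dotNl; lra.
have A0 : 0 < C0 + c by exact: addr_gt0.
(* The multiple that optimises [key]. *)
have := key ((2 * (C0 + c))^-1 *: (p' - P)).
rewrite dotZr -sqnormE sqnormZ; set S := sqnorm _; set g := _ - s * _.
set A := C0 + c in A0 *.
have -> : (2 * A)^-1 * S = S / (4 * A) * 2 by field; rewrite gt_eqF.
have -> : A * ((2 * A)^-1 ^+ 2 * S) = S / (4 * A) by field; rewrite gt_eqF.
move=> h; rewrite mulrC -ler_pdivrMr ?mulr_gt0//; lra.
Qed.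

(** By [gradient_gap], the excess over the lower bound on a good line at
    distance [e'] from the characteristic satisfies a Gronwall inequality with
    a source of order [e' ^+ 2]. *)
Lemma characteristic_value y t : 0 <= t <= T ->
  f (t, char t y) = f (0, y) + t * char_rate (g0 y).
Proof.
move=> tT; rewrite /char_map; set p0 := g0 y; set q := char_speed p0.
have /andP[t0 tT'] := tT.
have sub s : 0 <= s <= t -> 0 <= s <= T by lra.
apply/eqP; rewrite eq_le lower_bound// andbT.
have [C0 C00 f0lb] := C11_lower_bound f0C11.
have [_ /lipschitz_const[L L0 LP]] := f0C11.
have [C1 C10 C1P] := quadratic_upper_bound HC2 Hconv K.
pose A := 8 * C1 * (C0 + c) + 1.
pose B := 2 * C1 * d%:R * L ^+ 2.
have A0 : 0 < A.
  by rewrite ltr_wpDl// !mulr_ge0// addr_ge0 ?ltW.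
have B0 : 0 <= B by rewrite !mulr_ge0 ?sqr_ge0.
pose D := 2 * K + B / A * expR (A * t).
have D0 : 0 <= D by rewrite addr_ge0 ?mulr_ge0 ?expR_ge0 ?invr_ge0// ltW.
apply/ler_addgt0Pr => e e0.
pose e' := Num.min 1 (e / (D + 1)).
have D1 : 0 < D + 1 by rewrite ltr_wpDl.
have e'0 : 0 < e' by rewrite lt_min ltr01 divr_gt0.
have e'1 : e' <= 1 by rewrite ge_min lexx.
have [z yz [N N0 NP]] := good_line q y e'0.
pose g s := f (s, z - s *: q) - f (0, z) - s * char_rate p0.
have gt : g t <= B * e' ^+ 2 / A * expR (A * t).
  apply: (@gronwall_ae R g t (K * (1 + `|q|) + `|char_rate p0|) A _ N t0 A0).
  - by rewrite !mulr_ge0 ?sqr_ge0 ?invr_ge0// ltW.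
  - move=> s r /sub sT /sub rT.
    have -> : g s - g r = (f (s, z - s *: q) - f (r, z - r *: q)) - (s - r) *
      char_rate p0.
      by rewrite /g; ring.
    rewrite (le_trans (ler_normB _ _))// [leRHS]mulrDl lerD//;
      last by rewrite normrM mulrC.
    exact: lipschitz_line.
  - exact: N0.
  - move=> s /andP[s0 st] Ns.
    have sT : 0 <= s <= T by apply: sub; rewrite !ltW.
    have [P jP] := NP s sT Ns.
    have ig : is_derive s 1 g (H P - dot P q - char_rate p0).
      have id := jet_is_derive_line jP.
      rewrite /g; apply: is_derive_eq.
      by rewrite /GRing.scale/=; ring.
    split; first exact: (ex_derive (is_derive := ig)).
    rewrite derive1E (derive_val (is_derive := ig)).
    have h1 := gradient_gap C00 f0lb sT jP.
    have h2 := C1P p0 P (f0_grad_bound y) (jet_grad_bound sT jP).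
    set p' := g0 z in h1.
    (* [p'] is the initial gradient on the good line, [p0] the one at [y]. *)
    have h3 : sqnorm (P - p0) <= 2 * sqnorm (p' - P) + 2 * sqnorm (p' - p0).
      rewrite -(sqnormN (p' - P)) opprB.
      by have := sqnormD_le (P - p') (p' - p0); rewrite addrA subrK.
    have h4 : sqnorm (p' - p0) <= d%:R * (L ^+ 2 * e' ^+ 2).
      apply: (le_trans (sqnorm_le_norm _)); rewrite ler_wpM2l// -exprMn.
      rewrite lerXn2r ?nnegrE ?mulr_ge0 ?(ltW e'0)//.
      by apply: (le_trans (LP z y _ _)) => //; rewrite ler_wpM2l// ltW.
    have h5 : C1 * sqnorm (P - p0) <=
        C1 * (2 * (4 * (C0 + c) * g s) + 2 * (d%:R * (L ^+ 2 * e' ^+ 2))).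
      by rewrite ler_wpM2l//; rewrite -/(g s) in h1; lra.
    have g0 : 0 <= g s.
      by have := lower_bound p0 z sT; rewrite -/q /g; lra.
    have -> : A * (g s + B * e' ^+ 2 / A) = A * g s + B * e' ^+ 2.
      by field; rewrite gt_eqF.
    rewrite dotDr dotNr -/(char_speed p0) -/q (dotC q P) in h2.
    rewrite /char_rate -/(char_speed p0) -/q /A /B; lra.
  - by rewrite /g scale0r subr0 mul0r subr0 subrr.
have zT : 0 <= (0 : R) <= T by rewrite lexx T0.
have h2 : `|f (0, y) - f (0, z)| <= K * e'.
  by rewrite (le_trans (lipschitz_x _ _ zT))// ler_wpM2l// distrC ltW.
have h3 : `|f (t, z - t *: q) - f (t, y - t *: q)| <= K * e'.
  rewrite (le_trans (lipschitz_x _ _ tT))// ler_wpM2l// ltW//.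
  by rewrite opprB addrA subrK.
have h4 : (D + 1) * e' <= e.
  by rewrite mulrC -ler_pdivlMr// ge_min lexx orbT.
have h5 : B * e' ^+ 2 / A * expR (A * t) <= B / A * expR (A * t) * e'.
  have -> : B * e' ^+ 2 / A * expR (A * t) =
    B / A * expR (A * t) * e' ^+ 2 by ring.
  rewrite ler_wpM2l ?mulr_ge0 ?expR_ge0 ?invr_ge0 ?(ltW A0)// expr2 ler_piMl//.
  exact: ltW.
move: h2 h3; rewrite !ler_norml => /andP[h2 h2'] /andP[h3 h3'].
rewrite /g in gt; rewrite /D in h4; lra.
Qed.

(** At the end of a characteristic the lower bound is attained, so that it
    becomes a paraboloid touching [f (t, -)] from below. *)
Lemma lower_parabola C0 y t h :
  (forall y z, f (0, y) + dot (g0 y) z - C0 * sqnorm z <= f (0, y + z)) ->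
  0 <= t <= T ->
  f (t, char t y) + dot (g0 y) h - C0 * sqnorm h <= f (t, char t y + h).
Proof.
move=> f0lb tT; rewrite characteristic_value//; set p0 := g0 y; set x :=
  char t y.
have := lower_bound p0 (y + h) tT; have := f0lb y h; rewrite -/p0.
have -> : y + h - t *: char_speed p0 = x + h by rewrite /x addrAC.
lra.
Qed.

(** A semiconcave function touched from below by a paraboloid is
    differentiable there: the end point is a barycentre of [x + h] and of [x -
    k h], and at the latter the lower paraboloid bounds [f] up to order [k ^+
    2]. *)
Lemma upper_parabola y t h : 0 <= t <= T ->
  f (t, char t y + h) <= f (t, char t y) + dot (g0 y) h + c * sqnorm h.
Proof.
move=> tT; set p0 := g0 y; set x := char t y.
have [C0 C00 f0lb] := C11_lower_bound f0C11.
apply/ler_addgt0Pr => e e0.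
have S0 := sqnorm_ge0 h.
pose D := (C0 + c) * sqnorm h.
have D0 : 0 <= D by rewrite mulr_ge0// addr_ge0 ?(ltW C00) ?(ltW c0).
have D1 : 0 < D + 1 by rewrite ltr_wpDl.
(* The error left by the barycentre is [k * D]. *)
pose k := e / (D + 1).
have k0 : 0 < k by rewrite divr_gt0.
have k1 : 0 < 1 + k by rewrite addr_gt0.
have h1 := lower_parabola y (- (k *: h)) f0lb tT.
rewrite -/p0 -/x sqnormN sqnormZ dotNr dotZr in h1.
have s01 : 0 <= k / (1 + k) <= 1.
  by apply/andP; split; [rewrite divr_ge0 ?(ltW k0) ?(ltW k1) |
    rewrite ler_pdivrMr//; lra].
have := fsc (x - k *: h) ((1 + k) *: h) tT s01.
have -> : x - k *: h + (1 + k) *: h = x + h.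
  by rewrite scalerDl scale1r addrCA subrK addrC.
have -> : x - k *: h + (k / (1 + k)) *: ((1 + k) *: h) = x.
  by rewrite scalerA divfK ?gt_eqF// subrK.
rewrite sqnormZ => h2.
have E : 1 - k / (1 + k) = (1 + k)^-1 by field; rewrite gt_eqF.
rewrite E in h2.
have h3 : k * f (t, x + h) + f (t, x - k *: h) - c * k * (1 + k) * sqnorm h <=
  (1 + k) * f (t, x).
  have := ler_wpM2l (ltW k1) h2; set F := (1 + k) * (_ - _).
  suff -> : F = k * f (t, x + h) + f (t, x - k *: h) - c * k * (1 + k) * sqnorm
    h by [].
  by rewrite /F; field; rewrite gt_eqF.
have h4 : k * f (t, x + h) <= k * (f (t, x) + dot p0 h + c * sqnorm h + k * D).
  by rewrite /D; lra.
rewrite ler_pM2l// in h4; apply: (le_trans h4); rewrite lerD2l.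
by rewrite /k mulrAC ler_pdivrMr// ler_pM2l// lerDl.
Qed.

End ae_solution.

(** * Characteristics fill space *)

(** Joins the complete and the normed structures of row vectors, as the fixed
    point theorem requires. *)
HB.instance Definition _ (R : realType) (d : nat) := Complete.on 'rV[R]_d.

Lemma contraction_fixed_point (R : realType) (d : nat)
  (F : 'rV[R]_d -> 'rV[R]_d) (k : R) :
  0 <= k < 1 -> (forall x y, `|F x - F y| <= k * `|x - y|) -> exists x, x = F x.
Proof.
move=> /andP[k0 k1] FL.
have Ff : set_fun setT setT F by [].
pose FF : {fun [set: 'rV[R]_d] >-> [set: 'rV[R]_d]} := mkfun_fun Ff.
have [|||x _ xE] := @banach_fixed_point R 'rV[R]_d setT FF.
- exists (NngNum k0); split => //= -[x y] _; exact: FL.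
- exact: closedT.
- by exists 0.
- by exists x.
Qed.

Section characteristics_onto.
Context {R : realType} {d : nat}.
Local Notation V := 'rV[R]_d.
Variables (T : R) (H : V -> R) (f : R * V -> R) (c C0 K : R).
Local Notation char_speed := (@char_speed R d H).
Local Notation g0 := (@init_grad R d f).
Local Notation char := (@char_map R d H f).
Hypotheses (HC2 : Ck_on 2 setT H) (c0 : 0 < c) (C00 : 0 < C0).
Hypothesis g0K : forall y, `|g0 y| <= K.
Hypothesis lower : forall y t h, 0 <= t <= T ->
  f (t, char t y) + dot (g0 y) h - C0 * sqnorm h <= f (t, char t y + h).
Hypothesis upper : forall y t h, 0 <= t <= T ->
  f (t, char t y + h) <= f (t, char t y) + dot (g0 y) h + c * sqnorm h.

(** Slopes of functions squeezed between two families of paraboloids vary in a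
    Lipschitz way: evaluate the lower paraboloid at one point and the upper
    one at the other, at a displacement parallel to the difference of the
    slopes. *)
Lemma gradient_lipschitz_along t y y' : 0 <= t <= T ->
  sqnorm (g0 y - g0 y') <= 4 * (c + 2 * C0) ^+ 2 * sqnorm
    (char t y' - char t y).
Proof.
move=> tT; set x := char t y; set x' := char t y'; set D := x' - x.
set p := g0 y; set p' := g0 y'; set C1 := c + 2 * C0.
have C10 : 0 < C1 by rewrite addr_gt0// mulr_gt0.
have xD : x' = x + D by rewrite /D addrC subrK.
have key h : dot (p - p') h <= C1 * (sqnorm D + sqnorm h).
  have h1 := lower y (D + h) tT.
  have h2 := upper y' h tT.
  have h3 := upper y D tT.
  rewrite -/x -/x' -/p -/p' in h1 h2 h3; rewrite addrA -xD in h1;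
    rewrite -xD in h3.
  have h4 := ler_wpM2l (ltW C00) (sqnormD_le D h).
  have h5 := mulr_ge0 (ltW c0) (sqnorm_ge0 D).
  rewrite dotDr in h1; rewrite dotDl dotNl /C1.
  clearbody D p p' x x'; clear C10 xD.
  move: (f _) (f _) (f _) (dot _ _) (dot _ _) (dot _ _) (sqnorm _) (sqnorm _)
    (sqnorm _) h1 h2 h3 h4 h5 => *.
    lra.
have := key ((2 * C1)^-1 *: (p - p')).
rewrite dotZr -sqnormE sqnormZ; set S := sqnorm (p - p').
have -> : (2 * C1)^-1 * S = S / (4 * C1) * 2 by field; rewrite gt_eqF.
rewrite [leRHS]mulrDr.
have -> : C1 * ((2 * C1)^-1 ^+ 2 * S) = S / (4 * C1) by field; rewrite gt_eqF.
move=> h.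
have : S / (4 * C1) <= C1 * sqnorm D by lra.
rewrite ler_pdivrMr ?mulr_gt0// => /le_trans; apply.
by rewrite le_eqVlt; apply/orP; left; apply/eqP; ring.
Qed.

(** The velocity is a Lipschitz function of the position at time [t], with a
    constant that does not depend on [t]; this uniformity lets [char_onto]
    advance by time steps of fixed length. *)
Lemma flow_lipschitz_along : exists2 C, 0 <= C & forall t y y', 0 <= t <= T ->
  `|char_speed (g0 y) - char_speed (g0 y')| <= C * `|char t y - char t y'|.
Proof.
have [C C0' CP] := grad_locally_lipschitz HC2 K.
set C1 := 2 * (c + 2 * C0).
have C10 : 0 <= C1 by rewrite !(mulr_ge0, addr_ge0)// ltW.
exists (C * (C1 * (d%:R + 1))).
  by do 2 (apply: mulr_ge0 => //); exact: addr_ge0.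
move=> t y y' tT.
apply: (le_trans (CP _ _ (g0K y') (g0K y))).
rewrite -mulrA; apply: ler_wpM2l => //.
have dR : 0 <= d%:R :> R by [].
have sq (r : R) : 0 <= r -> r <= (r + 1) ^+ 2 by move=> r0; nra.
have d1 : 0 <= d%:R + 1 :> R by exact: addr_ge0.
have n1 : `|g0 y - g0 y'| \is Num.nneg by rewrite nnegrE.
have n2 : C1 * (d%:R + 1) * `|char t y - char t y'| \is Num.nneg.
  by rewrite nnegrE; apply: mulr_ge0 => //; exact: mulr_ge0.
rewrite -(@ler_pXn2r _ 2 _ _ _ n1 n2)//.
apply: (le_trans (norm_le_sqnorm _)).
have h0 := gradient_lipschitz_along y' y tT.
rewrite -opprB sqnormN; apply: (le_trans h0).
set D := char t y - char t y'.
have h1 := sqnorm_le_norm D.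
have -> : 4 * (c + 2 * C0) ^+ 2 = C1 ^+ 2 by rewrite /C1; ring.
rewrite [leRHS]exprMn [(C1 * _) ^+ 2]exprMn -[leRHS]mulrA.
apply: ler_wpM2l; first exact: sqr_ge0.
apply: (le_trans h1); apply: ler_wpM2r; first exact: sqr_ge0.
exact: sq.
Qed.

(** If the characteristics cover space at time [r], the point that reaches
    [x0] at time [r + h] is a fixed point of [z |-> x0 + h v z], with [v] the
    velocity as a function of the position at time [r]. This is a contraction
    for small [h], and [t] is reached in finitely many equal steps. *)
Lemma char_onto t : 0 <= t <= T -> forall x, exists y, char t y = x.
Proof.
move=> /andP[t0 tT].
have [C CC0 CP] := flow_lipschitz_along.
have step r h : 0 <= r -> 0 <= h -> r + h <= T -> h * C < 1 ->
    (forall x, exists y, char r y = x) -> forall x, exists y, char (r + h) y =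
      x.
  move=> r0 h0 rh hC /choice[Y YP] x0.
  have [|z z'|z zE] := @contraction_fixed_point R d
    (fun z => x0 + h *: char_speed (g0 (Y z))) (h * C).
  - by rewrite mulr_ge0.
  - rewrite opprD addrACA subrr add0r -scalerBr normrZ ger0_norm// -mulrA
      ler_wpM2l//.
    have rT : 0 <= r <= T by rewrite r0; lra.
    by have := CP r (Y z) (Y z') rT; rewrite !YP.
  - exists (Y z); rewrite /char_map scalerDl opprD addrA.
    rewrite -[Y z - _]/(char r (Y z)) YP.
    by apply/eqP; rewrite subr_eq; apply/eqP.
have [n nP] : exists n : nat, t * C < n.+1%:R.
  exists (Num.truncn (t * C)); exact: truncnS_gt.
have n0 : 0 < n.+1%:R :> R by [].
have ontok k : (k <= n.+1)%N ->
  forall x, exists y, char (k%:R * (t / n.+1%:R)) y = x.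
  elim: k => [_ x|k IH kn].
    by exists x; rewrite /char_map mul0r scale0r subr0.
  rewrite -natr1 mulrDl mul1r; apply: step.
  - by rewrite mulr_ge0// divr_ge0.
  - by rewrite divr_ge0.
  - rewrite -[X in _ + X]mul1r -mulrDl natr1 mulrCA; apply: le_trans tT.
    by rewrite ler_piMr// ler_pdivrMr// mul1r ler_nat.
  - by rewrite mulrAC ltr_pdivrMr// mul1r.
  - by apply: IH; exact: ltnW.
by have := ontok n.+1 (leqnn _); rewrite mulrC divfK// gt_eqF.
Qed.

End characteristics_onto.

(** * The almost everywhere solution is a viscosity solution *)

Lemma near_line (R : realType) (d : nat) (p w : R * 'rV[R]_d)
  (Q : R * 'rV[R]_d -> Prop) :
  (\forall q \near p, Q q) -> \forall h \near (0 : R), Q (h *: w + p).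
Proof.
move=> Qp; have cv : h *: w + p @[h --> (0 : R)] --> p.
  suff : h *: w + p @[h --> (0 : R)] --> 0 *: w + p by rewrite scale0r add0r.
  apply: cvgD; last exact: cvg_cst.
  by apply: cvgZr_tmp; exact: cvg_id.
exact: cv.
Qed.

Section viscosity.
Context {R : realType} {d : nat}.
Local Notation V := 'rV[R]_d.
Variables (T : R) (H : V -> R) (f : R * V -> R) (c C0 : R).
Local Notation char_speed := (@char_speed R d H).
Local Notation char_rate := (@char_rate R d H).
Local Notation g0 := (@init_grad R d f).
Local Notation char := (@char_map R d H f).
Hypothesis value : forall t y, 0 <= t <= T ->
  f (t, char t y) = f (0, y) + t * char_rate (g0 y).
Hypothesis lower : forall y t h, 0 <= t <= T ->
  f (t, char t y) + dot (g0 y) h - C0 * sqnorm h <= f (t, char t y + h).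
Hypothesis upper : forall y t h, 0 <= t <= T ->
  f (t, char t y + h) <= f (t, char t y) + dot (g0 y) h + c * sqnorm h.
Hypothesis onto : forall t, 0 <= t <= T -> forall x, exists y, char t y = x.

(** In space, the paraboloids that squeeze [f] fix the gradient of [psi].
    Along the characteristic [f] is affine, which fixes one more directional
    derivative of [psi], hence its time derivative. The sign [s] treats
    contact from above and from below at once. *)
Lemma touching_jet (s D t : R) (y : V) (psi : R * V -> R) (a : R) (P : V) :
  0 < t < T -> 
  has_jet psi (t, char t y) a P ->
  (forall h, s * dot (g0 y) h - D * sqnorm h <=
             s * (f (t, char t y + h) - f (t, char t y))) ->
  (\forall q \near (t, char t y), s * (f q - f (t, char t y)) <=
    psi q - psi (t, char t y)) ->
  a = s * H (g0 y) /\ P = s *: g0 y.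
Proof.
move=> /andP[t0 tT] jpsi para touch; set x := char t y; set p0 := g0 y; set q :=
  char_speed p0.
have [dpsi _] := jpsi.
have PE : P = s *: p0.
  apply/rowP => i; rewrite -dot_delta -[in RHS]dot_delta dotZl.
  set v := delta_mx 0 i.
  have := jet_derive ((0, v) : R * V) jpsi; rewrite /= mul0r add0r => <-.
  apply: (@local_min_derive _ (R * V)%type psi _ _ _ (D * sqnorm v)).
    exact: diff_derivable.
  apply: filterS (near_line ((0, v) : R * V) touch) => h.
  rewrite line_pair /= mulr0 add0r (addrC (h *: v)).
  have := para (h *: v); rewrite -/x -/p0 dotZr sqnormZ.
  rewrite (_ : s * (h * dot p0 v) = h * (s * dot p0 v)); last by ring.
  rewrite (_ : D * (h ^+ 2 * sqnorm v) = D * sqnorm v * h ^+ 2); last by ring.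
  move=> h1 h2; lra.
split=> //.
have := jet_derive ((1, - q) : R * V) jpsi; rewrite /= mul1r dotNr.
rewrite (@local_min_derive _ (R * V)%type psi _ _ (s * char_rate p0) 0).
- rewrite PE dotZl /char_rate -/(char_speed p0) -/q (dotC p0 q) => E.
  by apply/eqP; rewrite -subr_eq0; apply/eqP; lra.
- exact: diff_derivable.
have nT : \forall h \near (0 : R), 0 <= t + h <= T.
  have m0 : 0 < Num.min t (T - t) by rewrite lt_min t0 subr_gt0.
  exists (Num.min t (T - t)) => //= h; rewrite /ball_/= sub0r normrN lt_min.
  move=> /andP[]; rewrite !ltr_norml => /andP[h1 h2] /andP[h3 h4].
  by apply/andP; split; lra.
apply: filterS2 nT (near_line ((1, - q) : R * V) touch) => h th.
rewrite line_pair /= mulr1 mul0r addr0.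
rewrite (_ : h *: - q + x = char (t + h) y); last first.
  by rewrite /x /char_map -/p0 -/q scalerN scalerDl opprD [RHS]addrA [LHS]addrC.
rewrite (addrC h) value// value; last by rewrite !ltW.
rewrite -/p0 => h1.
have E : s * (f (0, y) + (t + h) * char_rate p0 - (f (0, y) + t * char_rate p0))
  = h * (s * char_rate p0).
  by ring.
rewrite E in h1; lra.
Qed.

Lemma ae_subsolution : viscosity_subsolution H T f.
Proof.
move=> phi [t x] sphi tT ext.
have t0T : 0 < t < T by [].
have [y yx] : exists y, char t y = x.
  by apply: onto; move: t0T => /andP[? ?]; rewrite !ltW.
have dphi : differentiable phi (t, x) by have [+ _] := sphi 1%N; apply.
have tT' : 0 <= t <= T by move: t0T => /andP[? ?]; rewrite !ltW.
rewrite -yx in dphi ext *.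
have [||aE PE] := @touching_jet 1 C0 t y phi _ _ t0T (differentiable_jet dphi).
- by move=> h; have := lower y h tT'; lra.
- by apply: filterS ext => q; lra.
by rewrite PE aE mul1r scale1r subrr.
Qed.

Lemma ae_supersolution : viscosity_supersolution H T f.
Proof.
move=> phi [t x] sphi tT ext.
have t0T : 0 < t < T by [].
have [y yx] : exists y, char t y = x.
  by apply: onto; move: t0T => /andP[? ?]; rewrite !ltW.
have dphi : differentiable phi (t, x) by have [+ _] := sphi 1%N; apply.
have tT' : 0 <= t <= T by move: t0T => /andP[? ?]; rewrite !ltW.
rewrite -yx in dphi ext *.
have jphi := jetZ (-1) (differentiable_jet dphi).
have [||aE PE] := @touching_jet (-1) c t y _ _ _ t0T jphi.
- by move=> h; have := upper y h tT'; lra.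
- by apply: filterS ext => q; lra.
move/eqP: PE; rewrite !scaleN1r eqr_opp => /eqP ->.
by move: aE; rewrite !mulN1r => /eqP; rewrite eqr_opp => /eqP ->; rewrite subrr.
Qed.

End viscosity.

(** * A parabolic maximum principle *)

Section test_functions.
Context {R : realType} {d : nat}.
Local Notation V := 'rV[R]_d.
Implicit Types (f : R * V -> R) (p : R * V).

Lemma jetX f p a P n : has_jet f p a P ->
  has_jet (fun q => f q ^+ n.+1) p (n.+1%:R * f p ^+ n * a)
    ((n.+1%:R * f p ^+ n) *: P).
Proof.
move=> jf; elim: n => [|n IH].
  rewrite expr0 mulr1 mul1r scale1r.
  by rewrite (_ : (fun q => _) = f)//; apply/funext => q; rewrite expr1.
rewrite (_ : (fun q => _) = fun q => f q * f q ^+ n.+1); last first.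
  by apply/funext => q; rewrite exprS.
have := jetM jf IH; congr has_jet.
  by rewrite -[n.+2%:R]natr1 -[n.+1%:R in RHS]natr1 exprS; ring.
by rewrite scalerA -scalerDl; congr (_ *: _); rewrite -[n.+2%:R]natr1 exprS;
  ring.
Qed.

(** A barrier in time: it is increasing, and for large [n] it is negligible
    before [b] but equals [M] at [b]. *)
Definition ramp (M a b : R) (n : nat) (p : R * V) : R :=
  M * ((p.1 - a) / (b - a)) ^+ n.+1.

Lemma jet_ramp M a b n p : 0 < M -> a < b -> a < p.1 ->
  exists2 D, 0 < D & has_jet (ramp M a b n) p D 0.
Proof.
move=> M0 ab ap.
have ba0 : 0 < b - a by rewrite subr_gt0.
pose k := (b - a)^-1.
have k0 : 0 < k by rewrite invr_gt0.
have j1 : has_jet (fun q : R * V => q.1 * k + dot 0 q.2 + - (a * k)) p (k + 0)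
  (0 + 0).
  by apply: jetD; [exact: jet_linear | exact: jet_cst].
have E q : (q.1 - a) / (b - a) = q.1 * k + dot (0 : V) q.2 + - (a * k).
  by rewrite dot0l addr0 mulrBl.
have := jetZ M (jetX n j1); rewrite !addr0 !scaler0 -E => j2.
exists (M * (n.+1%:R * ((p.1 - a) / (b - a)) ^+ n * k)).
  by rewrite !mulr_gt0// exprn_gt0// divr_gt0// subr_gt0.
move: j2; congr has_jet; apply/funext => q; by rewrite /ramp E.
Qed.

Lemma smooth_ramp M a b n k : Ck_on k setT (ramp M a b n).
Proof.
have -> : ramp M a b n = fun q => M *
  (q.1 * (b - a)^-1 + dot (0 : V) q.2 + - (a / (b - a))) ^+ n.+1.
  by apply/funext => q; rewrite /ramp dot0l addr0 mulrBl.
apply: CkM; first exact: Ck_cst.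
by apply: CkX; apply: CkD; [exact: Ck_linear | exact: Ck_cst].
Qed.

(** Squared distance to the point [z - s v] at time [s]. *)
Definition bowl (v z : V) (p : R * V) : R := sqnorm (p.2 + p.1 *: v - z).

(** A sum of squares of affine functions, hence smooth and with an explicit
    jet. *)
Lemma bowlE v z : bowl v z = fun p => \sum_(i < d)
  (p.1 * v 0 i + dot (delta_mx 0 i) p.2 + - z 0 i) *
  (p.1 * v 0 i + dot (delta_mx 0 i) p.2 + - z 0 i).
Proof.
apply/funext => p; apply: eq_bigr => i _.
by rewrite !mxE dotC dot_delta expr2 [p.1 * v 0 i + _]addrC.
Qed.

Lemma jet_bowl v z p : let Y := p.2 + p.1 *: v - z in
  has_jet (bowl v z) p (2 * dot Y v) (2 *: Y).
Proof.
move=> Y; rewrite bowlE.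
pose A i (q : R * V) := q.1 * v 0 i + dot (delta_mx 0 i) q.2 + - z 0 i.
have jA i : has_jet (A i) p (v 0 i) (delta_mx 0 i).
  rewrite -[v 0 i]addr0 -[delta_mx 0 i]addr0.
  by apply: jetD; [exact: jet_linear | exact: jet_cst].
have AY i : A i p = Y 0 i.
  by rewrite /A /Y !mxE dotC dot_delta [p.1 * _ + _]addrC.
have := jet_sum (index_enum 'I_d) (fun i => jetM (jA i) (jA i)).
congr has_jet.
  by rewrite mulr_sumr; apply: eq_bigr => i _; rewrite AY; ring.
rewrite [in RHS](row_sum_delta Y) scaler_sumr; apply: eq_bigr => i _.
by rewrite AY -scalerDl scalerA; congr (_ *: _); ring.
Qed.

Lemma smooth_bowl v z k : Ck_on k setT (bowl v z).
Proof.
rewrite bowlE; apply: Ck_sum => i; apply: CkM;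
by apply: CkD; [exact: Ck_linear | exact: Ck_cst].
Qed.

Lemma ramp_continuous M a b n : continuous (ramp M a b n).
Proof. by move=> p; exact: (smooth_ramp M a b n 0). Qed.

End test_functions.

Lemma geometric_small (R : realType) (k M e : R) : 0 <= k < 1 -> 0 < M ->
  0 < e ->
  exists n, M * k ^+ n.+1 < e.
Proof.
move=> /andP[k0 k1] M0 e0.
have cv : (GRing.exp k : nat -> R) @ \oo --> 0.
  by apply: cvg_expr; rewrite ger0_norm.
have e1 : 0 < e / M by rewrite divr_gt0.
move/cvgr0_norm_lt: cv => /(_ _ e1)[n _ nP].
exists n; have := nP n.+1 (leqnSn n); rewrite /= ger0_norm ?exprn_ge0//.
by rewrite ltr_pdivlMr// mulrC.
Qed.

Lemma compact_cylinder (R : realType) (d : nat) (a b r : R) (x0 : 'rV[R]_d) :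
  compact [set p : R * 'rV[R]_d | a <= p.1 <= b /\ `|p.2 - x0| <= r].
Proof.
rewrite (_ : [set p | _] = `[a, b]%classic `*` [set x | `|x - x0| <= r]).
  by apply: compact_setX; [exact: segment_compact | exact: compact_norm_ball].
by apply/seteqP; split => -[t y] /=; rewrite in_itv.
Qed.

(** The ramp, of height larger than the oscillation of [w], keeps a positive
    maximum away from the final time, where the equation gives no information;
    it disappears as [n] tends to infinity. *)
Lemma parabolic_maximum (R : realType) (d : nat) (w : R * 'rV[R]_d -> R)
    (a b : R) (x0 : 'rV[R]_d) (r : R) :
  a < b -> 
  {within [set p | a <= p.1 <= b /\ `|p.2 - x0| <= r], continuous w} ->
  (forall x, `|x - x0| <= r -> w (a, x) <= 0) ->
  (forall s x, a <= s <= b -> `|x - x0| = r -> w (s, x) <= 0) ->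
  (forall M n p, 0 < M -> a < p.1 < b -> `|p.2 - x0| < r ->
    ~ (\forall q \near p, w q - ramp M a b n q <= w p - ramp M a b n p)) ->
  forall s x, a <= s < b -> `|x - x0| <= r -> w (s, x) <= 0.
Proof.
move=> ab cw bot lat int s x /andP[as_ sb] xr.
set Q := [set p | _] in cw.
have cQ : compact Q by exact: compact_cylinder.
rewrite leNgt; apply/negP => wpos.
have [M0 M00 M0P] := continuous_bounded_on_compact cQ cw.
pose M := M0 + 1.
have Mpos : 0 < M by rewrite ltr_wpDl.
have ba0 : 0 < b - a by rewrite subr_gt0.
have k01 : 0 <= (s - a) / (b - a) < 1.
  apply/andP; split; first by rewrite divr_ge0 ?subr_ge0// ltW.
  by rewrite ltr_pdivrMr// mul1r; lra.
have [n nP] := geometric_small k01 Mpos wpos.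
have Qs : Q (s, x) by split => //=; rewrite as_ ltW.
have cr : {within Q, continuous (ramp M a b n)}.
  by apply: continuous_subspaceT => q; exact: ramp_continuous.
have [|p pQ pmax] := @compact_EVT_max _ R (fun q => w q - ramp M a b n q) Q
  (ex_intro _ _ Qs) cQ.
  move=> q; apply: cvgB; first exact: cw.
  exact: cr.
rewrite inE in pQ.
have ppos : 0 < w p - ramp M a b n p.
  have := pmax (s, x); rewrite inE => /(_ Qs); apply: lt_le_trans.
  by rewrite subr_gt0.
case: p pQ pmax ppos => t y [/= /andP[at_ tb] yr] pmax ppos.
have rge0 : a <= t -> 0 <= ramp M a b n (t, y).
  by move=> ?; rewrite /ramp mulr_ge0 ?(ltW Mpos)// exprn_ge0// divr_ge0
    ?subr_ge0// ltW.
have at' : a < t.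
  rewrite lt_neqAle at_ andbT; apply/eqP => aE.
  have := bot y yr; have := rge0 at_; rewrite aE; lra.
have tb' : t < b.
  rewrite lt_neqAle tb andbT; apply/eqP => tE.
  have r1 : ramp M a b n (t, y) = M.
    by rewrite /ramp /= tE divff ?expr1n ?mulr1// gt_eqF.
  have := M0P (t, y); rewrite r1 in ppos.
  have Qt : Q (t, y) by split => //=; rewrite at_ tb.
  move=> /(_ Qt); rewrite ler_norml => /andP[_]; rewrite /M in ppos; lra.
have yr' : `|y - x0| < r.
  rewrite lt_neqAle yr andbT; apply/eqP => yE.
  have tab : a <= t <= b by rewrite at_ tb.
  have := lat t y tab yE; have := rge0 at_; lra.
apply: (int M n (t, y) Mpos) => //=; first by rewrite at' tb'.
have nQ : \forall q \near (t, y), Q q.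
  have m0 : 0 < Num.min (Num.min (t - a) (b - t)) (r - `|y - x0|).
    by rewrite !lt_min !subr_gt0 at' tb' yr'.
  have tt' (v : R) : t - v < t - a -> - (b - t) < t - v -> a <= v <= b.
    by move=> h1 h2; apply/andP; split; lra.
  apply/nbhs_ballP; eexists; first exact: m0.
  move=> [t' y']; rewrite -ball_normE /ball_/= prod_normE /= gt_max !lt_min.
  move=> /andP[/andP[/andP[h1 h2] _] /andP[_ h3]]; split => /=.
    move: h1 h2; rewrite !ltr_norml => /andP[_ h1] /andP[h2 _].
    exact: tt'.
  apply: (le_trans (ler_distD y y' x0)); rewrite (distrC y') -lerBrDr;
    exact: ltW.
apply: filterS nQ => q Qq; apply: pmax; by rewrite inE.
Qed.

(** * Supersolutions along straight lines *)

Section supersolution.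
Context {R : realType} {d : nat}.
Local Notation V := 'rV[R]_d.
Variables (T : R) (H : V -> R) (u : R * V -> R).
Hypotheses (HC2 : Ck_on 2 setT H) (Hconv : strictly_convex H).
Hypotheses (cu : continuous u) (usup : viscosity_supersolution H T u).

Lemma slice_continuous (g : R -> V) s : {for s, continuous g} ->
  {for s, continuous (fun t => u (t, g t))}.
Proof.
move=> cg; apply: (@continuous_comp _ _ _ (fun t => (t, g t)) u);
  last exact: cu.
by apply: (@cvg_pair _ _ _ (nbhs s) (nbhs s) (nbhs (g s)));
  [exact: cvg_id | exact: cg].
Qed.

Lemma line_continuous (q z : V) (s : R) :
  {for s, continuous (fun t : R => z - t *: q)}.
Proof.
apply: cvgB; first exact: cvg_cst.
by apply: cvgZr_tmp; exact: cvg_id.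
Qed.

(** Compare [u] from below with the affine profile along the line, minus a
    steep bowl around the line. The bowl moves with the line, so it solves the
    transport equation of velocity [- grad H p], and convexity of [H] makes
    the profile a subsolution. *)
Lemma supersolution_growth_lt p z a b : 0 <= a -> a < b -> b <= T ->
  u (a, z - a *: char_speed H p) + (b - a) * char_rate H p <=
    u (b, z - b *: char_speed H p).
Proof.
move=> a0 ab bT; set q := char_speed H p; set alpha := char_rate H p.
set U0 := u (a, z - a *: q).
apply/ler_addgt0Pr => e e0.
suff main s : a <= s < b -> U0 - e + (s - a) * alpha <= u (s, z - s *: q).
  pose g s := u (s, z - s *: q) - (s - a) * alpha.
  have cg : g s @[s --> b] --> g b.
    apply: cvgB; first exact: (slice_continuous (@line_continuous q z b)).
    apply: cvgM; last exact: cvg_cst.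
    by apply: cvgB; [exact: cvg_id | exact: cvg_cst].
  have : U0 - e <= g b.
    rewrite leNgt; apply/negP => lt.
    have /nbhs_ballP[r /= r0 rP] : \forall t \near b, g t < U0 - e.
      exact: (cvgr_lt _ cg _ lt).
    pose s := Num.max a (b - r / 2).
    have sb : s < b by rewrite gt_max ab/=; lra.
    have as_ : a <= s by rewrite le_max lexx.
    have rs : b - r / 2 <= s by rewrite le_max lexx orbT.
    have bs : ball b r s.
      by rewrite /ball/= gtr0_norm ?subr_gt0//; lra.
    have := rP s bs; have := main s; rewrite as_ sb => /(_ isT); rewrite /g;
      lra.
  rewrite /g; lra.
(* The ball contains the line, with a margin 1, at all times of [a, b]. *)
pose x0 := z - a *: q.
pose r := 1 + (b - a) * `|q|.
have r1 : 1 <= r by rewrite lerDl mulr_ge0// subr_ge0 ltW.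
pose Q := [set p : R * V | a <= p.1 <= b /\ `|p.2 - x0| <= r].
have [Mu Mu0 MuP] : exists2 M, 0 <= M & forall p, Q p -> `|u p| <= M.
  apply: continuous_bounded_on_compact; first exact: compact_cylinder.
  exact: continuous_subspaceT.
have QU0 : `|U0| <= Mu.
  by apply: MuP; split => /=; rewrite ?lexx ?ltW// subrr normr0; lra.
have [h h0 hP] : exists2 h, 0 < h & forall x, `|x - x0| < h -> U0 - e <=
  u (a, x).
  have cx : u (a, x) @[x --> x0] --> U0.
    apply: (@continuous_comp _ _ _ (fun x => (a, x)) u); last exact: cu.
    by apply: (@cvg_pair _ _ _ (nbhs x0) (nbhs a) (nbhs x0));
      [exact: cvg_cst | exact: cvg_id].
  have lt : U0 - e < U0 by lra.
  have /nbhs_ballP[h /= h0 hP] : \forall x \near x0, U0 - e < u (a, x).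
    exact: (cvgr_gt _ cx _ lt).
  exists h => // x xh; apply/ltW/hP; by rewrite -ball_normE /ball_/= distrC.
(* The steepness [k] makes the bowl exceed the oscillation [N] at distance 1
   (on the lateral boundary) and at distance [h] (at time [a], where closer
   points are handled by the continuity of [u]). *)
pose N := 2 * Mu + (b - a) * `|alpha|.
have N0 : 0 <= N by rewrite addr_ge0 ?mulr_ge0// subr_ge0 ltW.
pose k := N * (1 + (h ^+ 2)^-1).
have h20 : 0 < h ^+ 2 by rewrite exprn_gt0.
have k1 : N <= k.
  have -> : k = N + N * (h ^+ 2)^-1 by rewrite /k; ring.
  by rewrite lerDl mulr_ge0// invr_ge0 ltW.
have k2 : N <= k * h ^+ 2.
  have -> : k * h ^+ 2 = N * h ^+ 2 + N by rewrite /k; field; rewrite gt_eqF.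
  by rewrite lerDr mulr_ge0// ltW.
have k0 : 0 <= k by exact: le_trans k1.
pose C := U0 - e - a * alpha.
pose w0 (p : R * V) := (- k) * bowl q z p + (p.1 * alpha + dot 0 p.2) + C.
pose w p := w0 p - u p.
move=> sab.
have w0E s' x : w0 (s', x) = U0 - e - k * bowl q z (s', x) + (s' - a) * alpha.
  by rewrite /w0 /C dot0l /=; ring.
have alphaB s' : a <= s' <= b -> (s' - a) * alpha <= (b - a) * `|alpha|.
  move=> /andP[as_ sb]; have sa : 0 <= s' - a by lra.
  apply: (le_trans (ler_wpM2l sa (ler_norm alpha))).
  by rewrite ler_wpM2r//; lra.
have uB (s' : R) (x : V) : a <= s' <= b -> `|x - x0| <= r -> - Mu <= u (s', x).
  move=> s'ab xr; have : Q (s', x) by [].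
  by move=> /MuP; rewrite ler_norml => /andP[].
have U0B : U0 <= Mu by apply: le_trans QU0; exact: ler_norm.
have cw0 j : Ck_on j setT w0.
  apply: CkD; last exact: Ck_cst.
  by apply: CkD; [apply: CkM;
    [exact: Ck_cst | exact: smooth_bowl] | exact: Ck_linear].
suff : w (s, z - s *: q) <= 0.
  rewrite /w w0E /bowl /= subrK subrr sqnorm0; lra.
apply: (@parabolic_maximum R d w a b x0 r ab) => //.
- apply: continuous_subspaceT => p'; apply: cvgB; last exact: cu.
  exact: (cw0 0%N p' Logic.I).
- move=> x xr; rewrite /w w0E subrr mul0r addr0.
  have bE : bowl q z (a, x) = sqnorm (x - x0) by rewrite /bowl /=
    /x0 opprB addrA.
  have [xh|hx] := ltP `|x - x0| h.
    have := hP x xh; have := mulr_ge0 k0 (sqnorm_ge0 (x - x0)).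
    rewrite bE; lra.
  have : k * h ^+ 2 <= k * sqnorm (x - x0).
    apply: ler_wpM2l => //; apply: le_trans (norm_le_sqnorm _).
    by rewrite lerXn2r ?nnegrE// ltW.
  have aab : a <= a <= b by rewrite lexx ltW.
  have := uB a x aab xr; have := normr_ge0 alpha => ?.
  have : 0 <= (b - a) * `|alpha| by rewrite mulr_ge0// subr_ge0 ltW.
  rewrite bE /N in k2 *; lra.
- move=> s' x s'ab xr; rewrite /w w0E.
  have : k * 1 <= k * bowl q z (s', x).
    apply: ler_wpM2l => //; rewrite /bowl /=.
    apply: le_trans (norm_le_sqnorm _).
    rewrite -[leLHS](expr1n _ 2) lerXn2r ?nnegrE//.
    have -> : x + s' *: q - z = (x - x0) + (s' - a) *: q.
      by apply/rowP => i; rewrite /x0 !mxE; ring.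
    have := ler_normD (x - x0 + (s' - a) *: q) (- ((s' - a) *: q)).
    rewrite addrK xr normrN normrZ.
    move: s'ab => /andP[as_ sb]; rewrite ger0_norm ?subr_ge0//.
    have : (s' - a) * `|q| <= (b - a) * `|q| by rewrite ler_wpM2r//; lra.
    rewrite /r; lra.
  have xr' : `|x - x0| <= r by rewrite xr.
  have := uB s' x s'ab xr'; have := alphaB s' s'ab.
  rewrite /N in k1; lra.
- move=> M n p' M0 pab pr wmax.
  have /andP[ap pb] := pab.
  have [D D0 jr] := jet_ramp n M0 ab ap.
  pose phi (p : R * V) := w0 p + (-1) * ramp M a b n p.
  pose Y := p'.2 + p'.1 *: q - z.
  have jphi := jetD (jetD (jetD (jetZ (- k) (jet_bowl q z p'))
    (jet_linear alpha 0 p')) (jet_cst C p')) (jetZ (-1) jr).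
  rewrite -/Y -/phi !addr0 !scaler0 !addr0 in jphi.
  have [aE PE] := jet_partial (jphi : has_jet phi p' _ _).
  have := usup (phi := phi) (p := p').
  have sphi : smooth_on (open_cylinder T) phi.
    move=> m; apply: (Ck_onS (B := setT)) => //.
    apply: CkD; first exact: cw0.
    by apply: CkM; [exact: Ck_cst | exact: smooth_ramp].
  have oc : open_cylinder T p'.
    by rewrite /open_cylinder /= (le_lt_trans a0 ap) (lt_le_trans pb bT).
  have nphi : \forall q0 \near p', u p' - phi p' <= u q0 - phi q0.
    by apply: filterS wmax => q0; rewrite /w /phi; lra.
  move=> /(_ sphi oc nphi); rewrite aE PE.
  have := gradient_inequality HC2 Hconv p (- k *: (2 *: Y)).
  rewrite /alpha /char_rate dotDr dotNr -/(char_speed H p) -/q.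
  rewrite (dotC q (- k *: _)) !dotZl; lra.
- have /andP[as_ sb] := sab.
  have -> : z - s *: q - x0 = (a - s) *: q.
    by apply/rowP => i; rewrite /x0 !mxE; ring.
  rewrite normrZ distrC ger0_norm ?subr_ge0//.
  have : (s - a) * `|q| <= (b - a) * `|q| by rewrite ler_wpM2r//; lra.
  rewrite /r; lra.
Qed.

Lemma supersolution_growth p z a b : 0 <= a -> a <= b -> b <= T ->
  u (a, z - a *: char_speed H p) + (b - a) * char_rate H p <=
    u (b, z - b *: char_speed H p).
Proof.
move=> a0; rewrite le_eqVlt => /orP[/eqP <- _|ab bT];
  last exact: supersolution_growth_lt.
by rewrite subrr mul0r addr0.
Qed.

End supersolution.

(** * Coercivity of the Hamiltonian *)

Section coercivity.
Context {R : realType} {d : nat}.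
Local Notation V := 'rV[R]_d.
Variables (H : V -> R).
Hypotheses (HC2 : Ck_on 2 setT H) (Hconv : strictly_convex H).

(** Tilting by [q = grad H 0] puts a minimum at the origin. *)
Definition tilt (q p : V) : R := H p - dot q p.

Lemma C2_continuous : continuous H.
Proof. by move=> x; apply/differentiable_continuous/C2_differentiable. Qed.

Lemma tilt_continuous q : continuous (tilt q).
Proof.
move=> p; rewrite /tilt; apply: (@cvgB _ _ _ (nbhs p) _ H (dot q));
  first exact: C2_continuous.
have : {for p, continuous (fun x : V => (0 : R, x).1 * 0 + dot q (0 : R, x).2)}.
  apply: (@continuous_comp _ _ _ (fun x : V => (0 : R, x))
    (fun z => z.1 * 0 + dot q z.2)).
    by apply: (@cvg_pair _ _ _ (nbhs p) (nbhs (0 : R)) (nbhs p));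
      [exact: cvg_cst | exact: cvg_id].
  exact: affine_continuous.
by rewrite (_ : (fun x : V => _) = dot q)//; apply/funext => x; rewrite /=
  mulr0 add0r.
Qed.

Lemma tilt_convex q x y s : 0 < s < 1 ->
  tilt q (s *: x + (1 - s) *: y) <= s * tilt q x + (1 - s) * tilt q y.
Proof.
move=> s01; rewrite /tilt dotDr !dotZr.
have [->|xy] := eqVneq x y.
  by rewrite -scalerDl (addrC s) subrK scale1r; lra.
have := Hconv xy s01; lra.
Qed.

Lemma tilt0_gt p : p != 0 -> tilt (grad H 0) 0 < tilt (grad H 0) p.
Proof.
move=> p0; have h : 0 < (2^-1 : R) < 1 by apply/andP; split; lra.
have h1 := Hconv p0 h.
have h2 := gradient_inequality HC2 Hconv 0 (2^-1 *: p + (1 - 2^-1) *: 0).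
rewrite subr0 scaler0 addr0 dotZr in h2; rewrite scaler0 addr0 in h1.
rewrite /tilt dot0r; lra.
Qed.

(** On the unit sphere the tilted Hamiltonian exceeds its minimum by some [m >
    0]; convexity along rays makes the excess grow linearly. *)
Lemma tilt_coercive : exists2 m, 0 < m & forall p, 1 <= `|p| ->
  tilt (grad H 0) 0 + m * `|p| <= tilt (grad H 0) p.
Proof.
set h := tilt (grad H 0).
pose S := [set p : V | `|p - 0| <= 1] `&` [set p : V | 1 <= `|p|].
have cS : compact S.
  apply: compact_closedI; first exact: compact_norm_ball.
  rewrite (_ : [set p : V | _] = (fun p : V => `|p|) @^-1` [set y | 1 <= y])//.
  by apply: closed_comp; [move=> x _;
    exact: norm_continuous | exact: closed_ge].
have scaleS (p : V) : 1 <= `|p| -> S (`|p|^-1 *: p).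
  move=> p1; have p0 : `|p| != 0 by rewrite gt_eqF// (lt_le_trans ltr01).
  by split; rewrite /= ?subr0 normrZ normfV normr_id mulVf.
have [[p0 Sp0]|S0] := pselect (S !=set0); last first.
  by exists 1 => // p /scaleS Sp; exfalso; apply: S0; exists (`|p|^-1 *: p).
have [|p1 p1S p1min] := @compact_EVT_min _ R h S (ex_intro _ _ Sp0) cS.
  by apply: continuous_subspaceT; exact: tilt_continuous.
rewrite inE in p1S.
exists (h p1 - h 0).
  rewrite subr_gt0; apply: tilt0_gt; rewrite -normr_gt0.
  by move: p1S => [_]; apply: lt_le_trans.
move=> p pge1.
have pgt0 : 0 < `|p| by rewrite (lt_le_trans ltr01).
have Sp := scaleS p pge1.
have h1 : h p1 <= h (`|p|^-1 *: p) by apply: p1min; rewrite inE.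
move: pge1; rewrite le_eqVlt => /orP[/eqP pE|plt1].
  by move: h1; rewrite -pE invr1 scale1r mulr1; lra.
have s01 : 0 < `|p|^-1 < 1 by rewrite invr_gt0 pgt0 invf_lt1.
have := tilt_convex (grad H 0) p 0 s01; rewrite scaler0 addr0 -/h => h2.
have : h p1 - h 0 <= `|p|^-1 * (h p - h 0) by lra.
rewrite mulrC ler_pdivlMr// mulrC; lra.
Qed.

(** The gradients of [H] need not fill space. Yet if [v] makes [dot v p - tilt
    (grad H 0) p] bounded above, then the shrunk vector [(1 - th) v] makes it
    coercive, and its maximum is attained. *)
Lemma gradient_attained (v : V) (B th : R) : 0 < th < 1 ->
  (forall p, dot v p - tilt (grad H 0) p <= B) ->
  exists p, grad H p = grad H 0 + (1 - th) *: v.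
Proof.
move=> /andP[th0 th1] vB; set q0 := grad H 0; set h := tilt q0.
have [m m0 mP] := tilt_coercive; rewrite -/q0 -/h in mP.
pose G p := h p - (1 - th) * dot v p.
have GE : G = tilt (q0 + (1 - th) *: v).
  by apply/funext => p; rewrite /G /h /tilt !dotE; ring.
have cG : continuous G by rewrite GE; exact: tilt_continuous.
pose r := 1 + `|(h 0 + (1 - th) * B - th * h 0) / (th * m)|.
have B0 : [set p : V | `|p - 0| <= r] 0 by rewrite /= subrr normr0 addr_ge0.
have [|p pr pmin] := @compact_EVT_min _ R G _ (ex_intro _ _ B0)
  (@compact_norm_ball R d 0 r).
  exact: continuous_subspaceT.
rewrite inE /= subr0 in pr.
have thm : 0 < th * m by rewrite mulr_gt0.
have pin : `|p| < r.
  rewrite ltNge; apply/negP => rp.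
  have p1 : 1 <= `|p| by apply: le_trans rp; rewrite lerDl.
  have := pmin 0; rewrite inE /=
    subrr normr0 => /(_ (addr_ge0 ler01 (normr_ge0 _))).
  have h1 := mP p p1; have h2 := vB p.
  have h3 : (1 - th) * (dot v p - h p) <= (1 - th) * B by rewrite ler_wpM2l//;
    lra.
  have h4 : th * (h 0 + m * `|p|) <= th * h p by rewrite ler_wpM2l// ltW.
  have h5 : h 0 + (1 - th) * B - th * h 0 < `|p| * (th * m).
    rewrite -ltr_pdivrMr//; apply: lt_le_trans rp; rewrite /r.
    by rewrite (le_lt_trans (ler_norm _))// ltrDr.
  have G0 : G 0 = h 0 by rewrite /G dot0r; ring.
  rewrite G0 /G; lra.
exists p.
have dG v' : 'D_v' H p = dot (q0 + (1 - th) *: v) v'.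
  apply: (@local_min_derive _ V H p v' _ 0).
    by apply: diff_derivable; exact: C2_differentiable.
  have rp0 : 0 < r - `|p| by rewrite subr_gt0.
  have v1 : 0 < `|v'| + 1 by rewrite ltr_wpDl.
  exists ((r - `|p|) / (`|v'| + 1)); first by rewrite /= divr_gt0.
  move=> k /=; rewrite sub0r normrN ltr_pdivlMr// => kr.
  have : G p <= G (k *: v' + p).
    apply: pmin; rewrite inE /= subr0 (le_trans (ler_normD _ _))// normrZ.
    have := normr_ge0 k; rewrite mulrDr in kr; lra.
  by rewrite GE /tilt dotDr dotZr; lra.
by apply/rowP => i; rewrite -dot_delta -[in RHS]dot_delta -dG derive_grad//;
  exact: C2_differentiable.
Qed.

End coercivity.

(** * Barriers on the lateral boundary of a large ball *)

(** Suppose that [u] dominates at [(s, y)] all the affine solutions [A + p .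
    (y - x1) - (t1 - s) H p]. Then [gradient_attained] provides a line of
    admissible velocity from [(s, y)] to a point [(t1, x1 + e)] with [|e| =
    1], and the growth of [u] on it forces [dot p e <= M1 - A]. But the
    velocity exceeds [grad H 0] by [gam e], and [gam] is large when the ball
    is large, so that [dot p e] is large by convexity of [H]. *)
Lemma lateral_barrier (R : realType) (d : nat) (H : 'rV[R]_d -> R)
    (u : R * 'rV[R]_d -> R) (t1 A : R) (x1 : 'rV[R]_d) :
  Ck_on 2 setT H -> strictly_convex H -> continuous u -> 0 < t1 ->
  (forall p z a b, 0 <= a -> a <= b -> b <= t1 ->
    u (a, z - a *: char_speed H p) + (b - a) * char_rate H p <=
      u (b, z - b *: char_speed H p)) ->
  exists2 r, 0 < r & forall s y, 0 <= s <= t1 -> `|y - x1| = r ->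
    exists p, u (s, y) < A + dot p (y - x1) - (t1 - s) * H p.
Proof.
move=> HC2 Hconv cu t10 grow.
set q0 := grad H 0; set h := tilt H q0.
have [M1 M10 M1P] : exists2 M, 0 <= M & forall x, `|x - x1| <= 1 ->
  `|u (t1, x)| <= M.
  have [|M M0 MP] := @continuous_bounded_on_compact R _ u
    _ (@compact_cylinder R d t1 t1 1 x1).
    exact: continuous_subspaceT.
  by exists M => // x x1'; apply: MP; rewrite /= lexx.
(* [k] exceeds by 1 the value of [dot p e] to be contradicted, once the loss
   of 1 allowed by the choice of [r] is taken into account. *)
pose k := `|M1 - A| + 2.
have k0 : 0 < k by rewrite ltr_wpDl.
have [Hk Hk0 HkP] : exists2 M, 0 <= M & forall p, `|p| <= k -> `|h p| <= M.
  have [|M M0 MP] := @continuous_bounded_on_compact R _ h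
    _ (@compact_norm_ball R d 0 k).
    by apply: continuous_subspaceT; exact: tilt_continuous.
  by exists M => // p pk; apply: MP; rewrite /= subr0.
pose r := t1 * `|q0| + 2 + t1 * (Hk + `|h 0|).
have r2 : t1 * `|q0| + 2 <= r.
  by rewrite lerDl mulr_ge0 ?addr_ge0// ltW.
have tq0 : 0 <= t1 * `|q0| by rewrite mulr_ge0// ltW.
exists r; first lra.
move=> s y /andP[s0 st] yr.
(* At time [t1] the Hamiltonian term vanishes and any steep slope works. *)
have [tau0|tau0] := leP (t1 - s) 0.
  have tau : t1 - s = 0 by lra.
  have S0 : 0 < sqnorm (y - x1).
    apply: lt_le_trans (norm_le_sqnorm _); rewrite exprn_gt0// yr; lra.
  exists (((`|u (s, y) - A| + 1) / sqnorm (y - x1)) *: (y - x1)).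
  rewrite tau mul0r subr0 dotZl -sqnormE divfK ?gt_eqF//.
  have := ler_norm (u (s, y) - A); lra.
apply: contrapT => no.
have {}no p : A + dot p (y - x1) - (t1 - s) * H p <= u (s, y).
  by rewrite leNgt; apply/negP => lt; apply: no; exists p.
set tau := t1 - s in tau0 no.
have taut1 : tau <= t1 by rewrite /tau; lra.
(* The displacement in the frame moving with velocity [- grad H 0]. *)
pose w := y - x1 - tau *: q0.
have wr : r - t1 * `|q0| <= `|w|.
  have := ler_normD w (tau *: q0); rewrite /w subrK yr normrZ gtr0_norm//.
  have : tau * `|q0| <= t1 * `|q0| by rewrite ler_wpM2r.
  lra.
have w2 : 2 <= `|w| by lra.
have w0 : 0 < `|w| by lra.
pose th := `|w|^-1.
have th0 : 0 < th by rewrite invr_gt0.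
have thw : th * `|w| = 1 by rewrite mulVf ?gt_eqF.
have th1 : th < 1 by rewrite invf_lt1//; lra.
pose v := tau^-1 *: w.
have tauv : tau *: v = w by rewrite scalerA divff ?scale1r// gt_eqF.
have vB p : dot v p - h p <= (u (s, y) - A) / tau.
  rewrite ler_pdivlMr// mulrC mulrBr -dotZl tauv.
  have := no p; rewrite /h /tilt mulrBr /w dotDl dotNl dotZl (dotC p); lra.
have th01 : 0 < th < 1 by rewrite th0.
have [p pE] := gradient_attained HC2 Hconv th01 vB; rewrite -/q0 in pE.
pose e := th *: w.
have e1 : `|e| = 1 by rewrite normrZ gtr0_norm.
have xE : y - tau *: grad H p = x1 + e.
  have E : tau *: ((1 - th) *: v) = (1 - th) *:
    w by rewrite scalerA mulrC -scalerA tauv.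
  rewrite pE scalerDr E /e.
  by apply/rowP => i; rewrite /w !mxE; ring.
have upper : u (s, y) + tau * char_rate H p <= M1.
  have := grow p (y + s *: grad H p) s t1 s0 st (lexx _).
  rewrite /char_speed addrK -/tau => /le_trans; apply.
  have -> : y + s *: grad H p - t1 *: grad H p = x1 + e.
    rewrite -xE /tau; by apply/rowP => i; rewrite !mxE; ring.
  apply: (le_trans (ler_norm _)); apply: M1P.
  by rewrite addrC addKr e1.
have pe : dot p e <= M1 - A.
  have := no p; have : dot p (y - x1) = tau * dot (grad H p) p + dot p e.
    rewrite (dotC _ p) -dotZr -dotDr; congr dot.
    have -> : e = y - tau *: grad H p - x1 by rewrite xE addrC addKr.
    by apply/rowP => i; rewrite !mxE; ring.
  move=> -> ; move: upper; rewrite /char_rate; lra.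
pose gam := (`|w| - 1) / tau.
have gam0 : 0 < gam by rewrite divr_gt0//; lra.
have gE : grad H p = q0 + gam *: e.
  rewrite pE; congr (_ + _); rewrite /v /e /gam !scalerA; congr (_ *: _).
  rewrite /th; field; by rewrite !gt_eqF.
have se1 : 1 <= sqnorm e by apply: le_trans (norm_le_sqnorm _);
  rewrite e1 expr1n.
have ineq := gradient_inequality HC2 Hconv p (k *: e).
rewrite gE dotDl dotZl dotDr dotNr in ineq.
rewrite (dotDr e) dotNr [dot e (k *: e)]dotZr -sqnormE (dotC e p) in ineq.
have hk : h (k *: e) <= Hk.
  apply: (le_trans (ler_norm _)); apply: HkP.
  by rewrite normrZ e1 mulr1 gtr0_norm.
have hp : h 0 <= h p.
  have [->//|p0] := eqVneq p 0; exact/ltW/tilt0_gt.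
have gamB : Hk + `|h 0| <= gam.
  rewrite ler_pdivlMr//; apply: (@le_trans _ _ ((Hk + `|h 0|) * t1)).
    by rewrite ler_wpM2l// addr_ge0.
  rewrite mulrC; move: wr; rewrite /r; lra.
have h0 := ler_norm (- h 0); rewrite normrN in h0.
have : gam * (k * sqnorm e - dot p e) <= gam.
  apply: le_trans gamB.
  have hpE : h p = H p - dot q0 p by [].
  have hkE : h (k *: e) = H (k *: e) - dot q0 (k *: e) by [].
  rewrite hkE in hk; rewrite hpE in hp; move: ineq;
    rewrite mulrDr mulrN => ineq.
  move: (h 0) (dot q0 _) (dot q0 _) (H p) (H _) h0 hk hp ineq => *.
  lra.
rewrite -[leRHS]mulr1 ler_pM2l//.
have : k * 1 <= k * sqnorm e by rewrite ler_wpM2l// ltW.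
have := ler_norm (M1 - A); rewrite /k; lra.
Qed.

(** * Comparison with another viscosity solution *)

(** Sum the tangent inequalities at the barycentre. *)
Lemma jensen_sum (R : realType) (d : nat) (H : 'rV[R]_d -> R)
    (I : Type) (r : seq I) (e : I -> R) (p : I -> 'rV[R]_d) :
  Ck_on 2 setT H -> strictly_convex H -> (forall i, 0 <= e i) ->
  0 < \sum_(i <- r) e i ->
  (\sum_(i <- r) e i) *
    H ((\sum_(i <- r) e i)^-1 *: \sum_(i <- r) e i *: p i) <=
  \sum_(i <- r) e i * H (p i).
Proof.
move=> HC2 Hconv e0 S0; set S := \sum_(i <- r) e i in S0 *.
set P := S^-1 *: _.
have SP : S *: P = \sum_(i <- r) e i *:
  p i by rewrite scalerA divff ?scale1r// gt_eqF.
have : \sum_(i <- r) e i * (H P + dot (grad H P) (p i - P)) <=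
  \sum_(i <- r) e i * H (p i).
  by apply: ler_sum => i _; rewrite ler_wpM2l//; exact: gradient_inequality.
apply: le_trans; rewrite le_eqVlt; apply/orP; left; apply/eqP.
have -> : \sum_(i <- r) e i * (H P + dot (grad H P) (p i - P)) =
    \sum_(i <- r) e i * H P + (dot (\sum_(i <- r) e i *: p i) (grad H P)
      - \sum_(i <- r) e i * dot P (grad H P)).
  rewrite dot_suml -sumrB -big_split/=; apply: eq_bigr => i _.
  rewrite dotDr dotNr dotZl (dotC (grad H P)) (dotC (grad H P)); ring.
by rewrite -!mulr_suml -/S -SP dotZl subrr addr0.
Qed.

(** Concavity of the logarithm. It replaces log-sum-exp by an affine function
    of the sum of exponentials, so that only exponentials have to be smooth.
    *)
Lemma ln_le_tangent (R : realType) (x y : R) : 0 < x -> 0 < y ->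
  ln y <= ln x + y / x - 1.
Proof.
move=> x0 y0; have yx : 0 < y / x by rewrite divr_gt0.
have := expR_ge1Dx (ln (y / x)); rewrite lnK ?posrE// ln_div ?posrE//; lra.
Qed.

Lemma le_left_limit (R : realType) (g : R -> R) (a b : R) :
  a < b -> {for b, continuous g} -> (forall s, a <= s < b -> g s <= 0) -> g b <=
    0.
Proof.
move=> ab cg gle; rewrite leNgt; apply/negP => lt.
have /nbhs_ballP[r /= r0 rP] :
  \forall t \near b, 0 < g t by exact: (cvgr_gt _ cg _ lt).
pose s := Num.max a (b - r / 2).
have sb : s < b by rewrite gt_max ab/=; lra.
have as_ : a <= s by rewrite le_max lexx.
have rs : b - r / 2 <= s by rewrite le_max lexx orbT.
have bs : ball b r s by rewrite /ball/= gtr0_norm ?subr_gt0//; lra.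
have := rP s bs; have := gle s; rewrite as_ sb => /(_ isT); lra.
Qed.

(** The characterisation of compactness by open covers is stated for pointed
    spaces. *)
HB.instance Definition _ (R : realType) (d : nat) :=
  Pointed.on (R * 'rV[R]_d)%type.

Section comparison.
Context {R : realType} {d : nat}.
Local Notation V := 'rV[R]_d.
Variables (T : R) (H : V -> R) (f u : R * V -> R) (c : R).
Local Notation char_speed := (@char_speed R d H).
Local Notation char_rate := (@char_rate R d H).
Local Notation g0 := (@init_grad R d f).
Local Notation char := (@char_map R d H f).
Hypotheses (HC2 : Ck_on 2 setT H) (Hconv : strictly_convex H).
Hypotheses (cf : continuous f) (cu : continuous u).
Hypothesis value : forall t y, 0 <= t <= T ->
  f (t, char t y) = f (0, y) + t * char_rate (g0 y).
Hypothesis upper : forall y t h, 0 <= t <= T ->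
  f (t, char t y + h) <= f (t, char t y) + dot (g0 y) h + c * sqnorm h.
Hypothesis onto : forall t, 0 <= t <= T -> forall x, exists y, char t y = x.
Hypothesis u0 : forall x, u (0, x) = f (0, x).
Hypothesis usub : viscosity_subsolution H T u.
Hypothesis usup : viscosity_supersolution H T u.

(** Both sides start from the same datum, and [f] realises equality in
    [supersolution_growth] along its own characteristics. *)
Lemma solution_ge t x : 0 <= t <= T -> f (t, x) <= u (t, x).
Proof.
move=> tT; have /andP[t0 tT'] := tT; have [y <-] := onto tT x; rewrite value//.
have := @supersolution_growth R d T H u HC2 Hconv cu usup (g0 y) y 0 t (lexx _)
  t0 tT'.
by rewrite scale0r !subr0 u0.
Qed.

(** A smooth function above [f] that touches it along the whole characteristic
    of [y], with the jet of a solution there. It stands in for [f], which is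
    not smooth enough to be part of a test function. *)
Definition osculating (y : V) (q : R * V) : R :=
  (q.1 * H (g0 y) + dot (g0 y) q.2) + (f (0, y) - dot (g0 y) y) +
  c * bowl (char_speed (g0 y)) y q.

Lemma osculating_ge y t x : 0 <= t <= T -> f (t, x) <= osculating y (t, x).
Proof.
move=> tT; have := upper y (x + t *: char_speed (g0 y) - y) tT; rewrite value//.
have -> : char t y + (x + t *: char_speed (g0 y) - y) = x.
  by rewrite /char_map; apply/rowP => i; rewrite !mxE; ring.
rewrite /osculating /bowl /=
  !dotDr dotNr dotZr /char_rate (dotC (g0 y) (char_speed _)).
rewrite -/(char_speed (g0 y)); lra.
Qed.

Lemma bowl_char y t : bowl (char_speed (g0 y)) y (t, char t y) = 0.
Proof. by rewrite /bowl /char_map /= subrK subrr sqnorm0. Qed.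

Lemma osculating_eq y t : 0 <= t <= T ->
  osculating y (t, char t y) = f (t, char t y).
Proof.
move=> tT; rewrite /osculating bowl_char value//=
  /char_map dotDr dotNr dotZr /char_rate.
rewrite (dotC (g0 y) (char_speed _)) -/(char_speed (g0 y)); ring.
Qed.

Lemma jet_osculating y t :
  has_jet (osculating y) (t, char t y) (H (g0 y)) (g0 y).
Proof.
have := jetD (jetD (jet_linear (H (g0 y)) (g0 y) (t, char t y))
  (jet_cst (f (0, y) - dot (g0 y) y) _))
  (jetZ c (jet_bowl (char_speed (g0 y)) y (t, char t y))).
have -> : (t, char t y).2 + (t, char t y).1 *: char_speed (g0 y) - y = 0.
  by rewrite /= /char_map subrK subrr.
by rewrite dot0l !mulr0 !scaler0 !addr0.
Qed.

Lemma smooth_osculating y k : Ck_on k setT (osculating y).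
Proof.
apply: CkD; last by apply: CkM; [exact: Ck_cst | exact: smooth_bowl].
by apply: CkD; [exact: Ck_linear | exact: Ck_cst].
Qed.

(** Compare [u] with [m * ln S], where [S] sums [expR (g / m)] over [f] and
    over finitely many affine solutions [ell p]. At an interior maximum,
    replace [f] by its osculating function and [ln] by its tangent: the jet of
    the test function is then a barycentre of jets [(H p, p)], on which
    Jensen's inequality contradicts the subsolution property. Finally let [m]
    tend to 0. *)
Lemma solution_le t1 x1 : 0 < t1 -> t1 <= T -> u (t1, x1) <= f (t1, x1).
Proof.
move=> t10 t1T; set A := f (t1, x1).
have grow p z a b : 0 <= a -> a <= b -> b <= t1 ->
    u (a, z - a *: char_speed p) + (b - a) * char_rate p <=
      u (b, z - b *: char_speed p).
  by move=> a0 ab bt; exact: (@supersolution_growth R d T H u HC2 Hconv cu usup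
    p z a b a0 ab (le_trans bt t1T)).
have [r r0 rP] := lateral_barrier A x1 HC2 Hconv cu t10 grow.
pose ell p (q : R * V) := (q.1 * H p + dot p q.2) + (A - dot p x1 - t1 * H p).
have ellE p s y : ell p (s, y) = A + dot p (y - x1) - (t1 - s) * H p.
  by rewrite /ell /= dotDr dotNr; ring.
have sell p k : Ck_on k setT (ell p) by apply: CkD;
  [exact: Ck_linear | exact: Ck_cst].
have [D DP] : exists D : seq V, forall s y, 0 <= s <= t1 -> `|y - x1| = r ->
    exists2 p, p \in D & u (s, y) < ell p (s, y).
  pose Q := [set q : R * V | 0 <= q.1 <= t1 /\ `|q.2 - x1| <= r] `&`
    [set q : R * V | r <= `|q.2 - x1|].
  have : compact Q.
    apply: compact_closedI; first exact: compact_cylinder.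
    rewrite (_ : [set q : R * V | _] =
      (fun q : R * V => `|q.2 - x1|) @^-1` [set y | r <= y])//.
    apply: closed_comp; last exact: closed_ge.
    move=> q _; apply: (@continuous_comp _ _ _ (fun q : R * V => q.2 - x1));
      last exact: norm_continuous.
    by apply: cvgB; [exact: cvg_snd | exact: cvg_cst].
  rewrite compact_cover => /(_ V setT (fun p => [set q | u q < ell p q]))
    [||D _ QD].
  - move=> p _; rewrite (_ : [set q | _] =
      (fun q => ell p q - u q) @^-1` [set y | 0 < y]).
      apply: open_comp; last exact: open_gt.
      by move=> q _; apply: cvgB; [exact: (sell p 0%N q Logic.I) | exact: cu].
    by apply/seteqP; split => q /=; rewrite subr_gt0.
  - move=> [s y] [[/= sT yr1] yr].
    have [p pP] := rP s y sT (le_anti (introT andP (conj yr1 yr))).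
    by exists p => //=; rewrite ellE.
  exists (finmap.enum_fset D) => s y sT yr.
  have [|p pD up] := QD (s, y).
    by split => /=; rewrite ?yr.
  by exists p.
have [N NP] : exists N : nat, forall m, 0 < m -> u (t1, x1) <=
  A + m * ln N.+1%:R.
  exists (size D) => m m0.
  (* The index [None] stands for [f], or for the function that replaces it. *)
  pose rs : seq (option V) := None :: map Some D.
  pose F (g : R * V -> R) (i : option V) : R * V -> R :=
    if i is Some p then ell p else g.
  pose S g q := \sum_(i <- rs) expR (F g i q / m).
  have Spos g q : 0 < S g q.
    rewrite /S big_cons ltr_pwDl ?expR_gt0//.
    by apply: sumr_ge0 => i _; exact: expR_ge0.
  pose w q := u q - m * ln (S f q).
  have cF i : continuous (F f i).
    by case: i => [p|//] q; exact: (sell p 0%N q Logic.I).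
  have cw : continuous w.
    move=> q; apply: cvgB; first exact: cu.
    apply: cvgM; first exact: cvg_cst.
    apply: (@continuous_comp _ _ _ (S f) (@ln R)); last exact: continuous_ln.
    rewrite /S; apply: cvg_big => [|i _]; first exact: add_continuous.
    apply: (@continuous_comp _ _ _ (fun q => F f i q / m) (@expR R)).
      by apply: cvgM; [exact: cF | exact: cvg_cst].
    exact: continuous_expR.
  have Sge g q i : i \in rs -> F g i q <= m * ln (S g q).
    move=> irs; rewrite mulrC -ler_pdivrMr// -[leLHS]expRK ler_ln ?posrE
      ?expR_gt0//.
    rewrite /S (big_rem i)//= lerDl; apply: sumr_ge0 => j _; exact: expR_ge0.
  have wle s x : 0 <= s < t1 -> `|x - x1| <= r -> w (s, x) <= 0.
    apply: (@parabolic_maximum R d w 0 t1 x1 r t10).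
    - exact: continuous_subspaceT.
    - move=> y _; rewrite /w u0 subr_le0; apply: (Sge f (0, y) None).
      by rewrite inE eqxx.
    - move=> s' y st yr; rewrite /w subr_le0.
      have [p pD up] := DP s' y st yr; apply: (le_trans (ltW up)).
      by apply: (Sge f (s', y) (Some p)); rewrite inE map_f ?orbT.
    move=> M n [t x'] M0 /andP[tp tlt] _ wmax.
    have tT : 0 <= t <= T by rewrite ltW//= (le_trans (ltW tlt)).
    have [y yx] := onto tT x'.
    have [Dr Dr0 jr] := jet_ramp n M0 t10 (p := (t, x')) tp.
    pose So := S (osculating y).
    pose S0 := S f (t, x').
    have S00 : 0 < S0 by exact: Spos.
    pose phi q := (m / S0) * So q + ramp M 0 t1 n q.
    have SoE : So (t, x') = S0.
      apply: eq_bigr => -[p _|_]; first by [].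
      by rewrite /F -yx osculating_eq.
    have sphi : smooth_on (open_cylinder T) phi.
      move=> k; apply: (Ck_onS (B := setT)) => //.
      apply: CkD; last exact: smooth_ramp.
      apply: CkM; first exact: Ck_cst.
      apply: Ck_sum => i; apply: Ck_expR; apply: CkM; last exact: Ck_cst.
      by case: i => [p|]; [exact: sell | exact: smooth_osculating].
    have oc : open_cylinder T (t, x') by rewrite /open_cylinder /=
      tp (lt_le_trans tlt).
    have nT : \forall q \near (t, x'), 0 <= q.1 <= T.
      exists (ball t (Num.min t (T - t)), setT) => /=.
        split; last exact: filterT.
        by apply: nbhsx_ballx; rewrite lt_min tp subr_gt0 (lt_le_trans tlt).
      move=> [s' z] [/= + _]; rewrite /ball/= lt_min !ltr_norml.
      move=> /andP[/andP[h1 h2] /andP[h3 h4]]; apply/andP; split; lra.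
    have ext : \forall q \near (t, x'), u q - phi q <= u (t, x') - phi (t, x').
      apply: filterS2 nT wmax => -[s' z] /= sT h.
      have h1 : S f (s', z) <= So (s', z).
        apply: ler_sum => -[p|] _ //=; rewrite ler_expR ler_pM2r ?invr_gt0//.
        exact: osculating_ge.
      have h2 := ln_le_tangent S00 (Spos f (s', z)).
      have h3 : m * ln (S f (s', z)) <= m * (ln S0 + So (s', z) / S0 - 1).
        rewrite ler_wpM2l ?(ltW m0)//; apply: (le_trans h2).
        by rewrite lerD2r lerD2l ler_pM2r ?invr_gt0.
      rewrite /phi SoE divfK ?gt_eqF//; move: h; rewrite /w -/S0.
      have -> : m / S0 * So (s', z) = m * (So (s', z) / S0) by ring.
      lra.
    pose sl (i : option V) : V := if i is Some p then p else g0 y.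
    pose e (i : option V) := expR (F (osculating y) i (t, x') / m).
    have jF i : has_jet (F (osculating y) i) (t, x') (H (sl i)) (sl i).
      case: i => [p|] /=; last by rewrite -yx; exact: jet_osculating.
      rewrite -[X in has_jet _ _ X _]addr0 -[X in has_jet _ _ _ X]addr0.
      by apply: jetD; [exact: jet_linear | exact: jet_cst].
    have jE i : has_jet (fun q => expR (F (osculating y) i q / m)) (t, x')
        (e i * (m^-1 * H (sl i))) (e i *: (m^-1 *: sl i)).
      have := jet_expR (jetZ m^-1 (jF i)).
      rewrite (mulrC m^-1 (F _ _ _)).
      have -> : (fun q => expR (m^-1 * F (osculating y) i q)) =
          (fun q => expR (F (osculating y) i q / m)).
        by apply/funext => q; rewrite mulrC.
      exact.
    have jphi := jetD (jetZ (m / S0) (jet_sum rs jE)) jr.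
    have [aE PE] := jet_partial (jphi : has_jet phi _ _ _).
    have := usub sphi oc ext; rewrite aE PE addr0.
    have SE : S0 = \sum_(i <- rs) e i by rewrite -SoE.
    have -> : m / S0 * \sum_(i <- rs) e i * (m^-1 * H (sl i)) =
        S0^-1 * \sum_(i <- rs) e i * H (sl i).
      rewrite -mulrA mulrC -mulrA; congr (_ * _); rewrite mulr_suml.
      by apply: eq_bigr => i _; field; rewrite gt_eqF.
    have -> : (m / S0) *: \sum_(i <- rs) e i *: (m^-1 *: sl i) =
        S0^-1 *: \sum_(i <- rs) e i *: sl i.
      rewrite mulrC -scalerA; congr (_ *: _); rewrite scaler_sumr.
      apply: eq_bigr => i _; rewrite !scalerA; congr (_ *: _).
      by field; rewrite gt_eqF.
    have := @jensen_sum R d H _ rs e sl HC2 Hconv (fun i => expR_ge0 _).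
    rewrite -SE => /(_ S00); rewrite mulrC -ler_pdivlMr// [X in _ <= X]mulrC;
      lra.
  have : w (t1, x1) <= 0.
    apply: (@le_left_limit R (fun s => w (s, x1)) 0 t1 t10).
      apply: (@continuous_comp _ _ _ (fun s => (s, x1)) w); last exact: cw.
      by apply: (@cvg_pair _ _ _ (nbhs t1) (nbhs t1) (nbhs x1));
        [exact: cvg_id | exact: cvg_cst].
    by move=> s st; apply: wle => //; rewrite subrr normr0 ltW.
  rewrite /w subr_le0 => /le_trans; apply.
  have -> : S f (t1, x1) = expR (A / m) * (size D).+1%:R.
    rewrite /S big_cons big_map /=.
    rewrite (eq_bigr (fun=> expR (A / m))); last first.
      by move=> p _; rewrite ellE subrr dot0r subrr mul0r addr0 subr0.
    rewrite big_const_seq count_predT iter_addr addr0 -natr1 mulrDr mulr1 addrC.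
    by rewrite mulr_natr.
  rewrite lnM ?posrE ?expR_gt0// expRK mulrDr mulrC divfK ?gt_eqF//.
apply/ler_addgt0Pr => e e0.
have l0 : 0 <= ln N.+1%:R :> R by apply: ln_ge0; rewrite ler1n.
have l1 : 0 < ln N.+1%:R + 1 :> R by rewrite ltr_wpDl.
have m0 : 0 < e / (ln N.+1%:R + 1) by rewrite divr_gt0.
apply: (le_trans (NP _ m0)); rewrite lerD2l.
by rewrite mulrAC ler_pdivrMr// ler_pM2l// lerDl.
Qed.

End comparison.

(** * Extension in time and conclusion *)

Section clamp.
Context {R : realType} {d : nat}.
Local Notation V := 'rV[R]_d.
Variables (T : R) (T0 : 0 <= T).

Definition clamp (s : R) : R := Num.min (Num.max s 0) T.

(** Freezing the time variable outside [0, T] makes a function that is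
    continuous on the cylinder continuous everywhere, without changing it on
    the cylinder. *)
Definition clamp_time (u : R * V -> R) (p : R * V) : R := u (clamp p.1, p.2).

Lemma clamp_in s : 0 <= clamp s <= T.
Proof. by rewrite /clamp ge_min lexx orbT andbT le_min T0 le_max lexx orbT. Qed.

Lemma clamp_id s : 0 <= s <= T -> clamp s = s.
Proof. by move=> /andP[s0 sT]; rewrite /clamp max_l// min_l. Qed.

Lemma clamp_timeE u p : cylinder T p -> clamp_time u p = u p.
Proof. by case: p => t x tT; rewrite /clamp_time clamp_id. Qed.

Lemma clamp_continuous : continuous clamp.
Proof.
move=> s; apply: (@continuous_min R R (fun s => Num.max s 0) (cst T));
  last exact: cvg_cst.
by apply: (@continuous_max R R id (cst 0)); [exact: cvg_id | exact: cvg_cst].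
Qed.

Lemma clamp_time_continuous u : {within cylinder T, continuous u} ->
  continuous (clamp_time u).
Proof.
move=> /subspace_continuousP cu p.
pose g (q : R * V) : R * V := (clamp q.1, q.2).
have gc q : cylinder T (g q) by exact: clamp_in.
have cg : g q @[q --> p] --> g p.
  apply: (@cvg_pair _ _ _ (nbhs p) (nbhs (clamp p.1)) (nbhs p.2));
    last exact: cvg_snd.
  apply: (@continuous_comp _ _ _ fst clamp); first exact: cvg_fst.
  exact: clamp_continuous.
move=> A /(cu _ (gc p)) /= nA.
have h : \forall q \near p, cylinder T (g q) -> A (u (g q)) := cg _ nA.
suff : \forall q \near p, A (clamp_time u q) by [].
by near=> q; apply: (near h q).
Unshelve. all: by end_near. Qed.

Lemma near_open_cylinder (p : R * V) : open_cylinder T p ->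
  \forall q \near p, cylinder T q.
Proof.
case: p => t x /andP[/= t0 tT].
have range (v : R) : t - v < t -> - (T - t) < t - v -> 0 <= v <= T.
  by move=> h1 h2; apply/andP; split; lra.
exists (ball t (Num.min t (T - t)), setT) => /=.
  split; last exact: filterT.
  by apply: nbhsx_ballx; rewrite lt_min t0 subr_gt0.
move=> [s z] [/= + _]; rewrite /ball/= lt_min !ltr_norml.
by move=> /andP[/andP[_ h1] /andP[h2 _]]; exact: range.
Qed.

Lemma open_cylinder_sub (p : R * V) : open_cylinder T p -> cylinder T p.
Proof. by move=> /andP[? ?]; rewrite /cylinder /= !ltW. Qed.

(** Test functions only see the values of [u] near points of the open
    cylinder, where clamping has no effect. *)
Lemma subsolution_clamp (H : V -> R) (u : R * V -> R) :
  viscosity_subsolution H T u ->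
  viscosity_subsolution H T (clamp_time u).
Proof.
move=> usub phi p sphi oc ext; apply: usub => //.
apply: filterS2 (near_open_cylinder oc) ext => q qT.
by rewrite !clamp_timeE//; exact: open_cylinder_sub.
Qed.

Lemma supersolution_clamp (H : V -> R) (u : R * V -> R) :
  viscosity_supersolution H T u ->
  viscosity_supersolution H T (clamp_time u).
Proof.
move=> usup phi p sphi oc ext; apply: usup => //.
apply: filterS2 (near_open_cylinder oc) ext => q qT.
by rewrite !clamp_timeE//; exact: open_cylinder_sub.
Qed.

Lemma lipschitz_within_continuous (u : R * V -> R) K : 0 <= K ->
  (forall p q, cylinder T p -> cylinder T q -> `|u p - u q| <= K * `|p - q|) ->
  {within cylinder T, continuous u}.
Proof.
move=> K0 uK; apply/subspace_continuousP => p pT.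
apply/cvgrPdist_lt => e e0.
have K1 : 0 < K + 1 by rewrite ltr_wpDl.
have h : \forall q \near p, `|p - q| < e / (K + 1).
  by apply: (@cvgr_dist_lt _ _ _ (nbhs p) _ id p);
    [exact: cvg_id | rewrite divr_gt0].
suff : \forall q \near p, cylinder T q -> `|u p - u q| < e by [].
near=> q => qT.
apply: (le_lt_trans (uK p q pT qT)).
apply: (@le_lt_trans _ _ ((K + 1) * `|p - q|));
  first by rewrite ler_wpM2r// lerDl.
rewrite mulrC -ltr_pdivlMr//; near: q; exact: h.
Unshelve. all: by end_near. Qed.

End clamp.

Theorem theorem1p1 (R : realType) (d : nat) (T : R)
    (H : 'rV[R]_d -> R) (f : R * 'rV[R]_d -> R)
    (hd : (1 <= d)%N) (hT : 0 <= T)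
    (HC2 : Ck_on 2 setT H) (Hconv : strictly_convex H)
    (flip : [lipschitz f p | p in cylinder T])
    (f0 : C11 (fun x => f (0, x)))
    (fae : HJ_ae H T f)
    (fconc : exists2 c : R, 0 < c & forall t : R, 0 <= t <= T ->
       convex_function setT (fun x : 'rV[R]_d => c * sqnorm x - f (t, x))) :
  viscosity_solution H T (fun x => f (0, x)) f /\
  (forall u : R * 'rV[R]_d -> R,
     viscosity_solution H T (fun x => f (0, x)) u ->
     forall p, cylinder T p -> f p = u p).
Proof.
have [K K0 fK] := lipschitz_const flip.
have [c c0 /semiconcave_of_convex fsc] := fconc.
have [C0 C00 f0lb] := C11_lower_bound f0.
have value t y (tT : 0 <= t <= T) :=
  characteristic_value hT HC2 Hconv K0 fK f0 fae c0 fsc y tT.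
have lower y t h (tT : 0 <= t <= T) :=
  lower_parabola hT HC2 Hconv K0 fK f0 fae c0 fsc y h f0lb tT.
have upper y t h (tT : 0 <= t <= T) :=
  upper_parabola hT HC2 Hconv K0 fK f0 fae c0 fsc y h tT.
have g0K := f0_grad_bound hT K0 fK f0.
have onto := char_onto HC2 c0 C00 g0K lower upper.
have cf := lipschitz_within_continuous K0 fK.
split.
  split => //.
  - exact: (ae_subsolution value lower onto).
  - exact: (ae_supersolution value upper onto).
move=> u [cu u0 usub usup] [t x] tT.
pose F := clamp_time T f; pose U := clamp_time T u.
have FE s y : 0 <= s <= T -> F (s, y) = f (s, y).
  by move=> sT; exact: clamp_timeE.
have zT : 0 <= (0 : R) <= T by rewrite lexx.
have F0 : (fun y => F (0, y)) = (fun y => f (0, y)).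
  by apply/funext => y; exact: FE.
have gE : init_grad F = init_grad f.
  by apply/funext => y; rewrite /init_grad F0.
have charE s y : char_map H F s y = char_map H f s y by rewrite /char_map gE.
have cF := clamp_time_continuous hT cf.
have cU := clamp_time_continuous hT cu.
have U0 y : U (0, y) = F (0, y) by rewrite /U /F !clamp_timeE.
have Usub := subsolution_clamp usub.
have Usup := supersolution_clamp usup.
have valueF s y : 0 <= s <= T ->
    F (s, char_map H F s y) = F (0, y) + s * char_rate H (init_grad F y).
  by move=> sT; rewrite !FE// charE gE value.
have upperF y s h : 0 <= s <= T ->
    F (s, char_map H F s y + h) <=
    F (s, char_map H F s y) + dot (init_grad F y) h + c * sqnorm h.
  by move=> sT; rewrite !FE// charE gE upper.
have ontoF s : 0 <= s <= T -> forall z, exists y, char_map H F s y = z.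
  by move=> sT z; have [y yE] := onto s sT z; exists y; rewrite charE.
have UE : U (t, x) = u (t, x) by exact: clamp_timeE.
rewrite -(FE t x tT) -UE; apply/eqP; rewrite eq_le; apply/andP; split.
  exact: (solution_ge HC2 Hconv cU valueF ontoF U0 Usup).
have /andP[t0 tT'] := tT; have [t_gt0|t_le0] := ltP 0 t.
  exact: (solution_le HC2 Hconv cF cU valueF upperF ontoF U0 Usub Usup).
have -> : t = 0 by apply/eqP; rewrite eq_le t_le0 t0.
by rewrite U0.
Qed.
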